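(* Let $n\ge 1$ and let $P\subset\mathbb{R}^n$ be a (bounded, convex) polyhedron containing the origin in its interior. Suppose that for every $k$ and every face $F\subset P$ of codimension $k$, the Euclidean distance from $0$ to the affine span of $F$ is at least $\sqrt{k}$. Then the $n$-dimensional volume of $P$ is at least $2^n$.
   Context: A polyhedron here is a bounded convex polyhedron, i.e. the convex hull of finitely many points (equivalently, a bounded intersection of finitely many closed half-spaces). Faces are nonempty. A face $F$ of $P$ has codimension $k$ if its affine span has dimension $n-k$; so $P$ itself is the face of codimension $0$, facets have codimension $1$, and vertices have codimension $n$. Volume is Lebesgue measure on $\mathbb{R}^n$, and distances are Euclidean. *)

(* Defs.v *)
From HB Require Import structures.
From mathcomp Require Import all_boot all_order all_algebra.
From mathcomp Require Import all_classical all_reals all_analysis.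

Set Implicit Arguments.
Unset Strict Implicit.
Unset Printing Implicit Defensive.

Import Order.TTheory GRing.Theory Num.Theory.
Import numFieldNormedType.Exports.

Local Open Scope classical_set_scope.
Local Open Scope ring_scope.

Section euclidean.
Context {R : realType} {n : nat}.
Implicit Types (u v x : 'rV[R]_n) (A : set 'rV[R]_n).

Definition dotp u v : R := \sum_(i < n) u 0 i * v 0 i.

(* The library's norm on matrices is the sup norm, so the Euclidean one has to
   be introduced separately; both induce the same topology. *)
Definition enorm v : R := Num.sqrt (dotp v v).

Definition edistance x A : R := inf [set enorm (y - x) | y in A].

End euclidean.

Section polytope.
Context {R : realType} {n : nat}.
Implicit Types (A P F : set 'rV[R]_n).

Definition convex_hull A : set 'rV[R]_n :=
  smallest (@convex_set R 'rV[R]_n) A.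

Definition polytope P :=
  exists s : seq 'rV[R]_n, P = convex_hull [set` s].

Definition affine_set A :=
  forall x y (t : R), A x -> A y -> A (t *: x + (1 - t) *: y).

Definition affine_span A : set 'rV[R]_n := smallest affine_set A.

Definition affine_dim A (d : nat) :=
  exists (x0 : 'rV[R]_n) (U : {vspace 'rV[R]_n}),
    \dim U = d /\ A = [set x0 + u | u in [set` U]].

(* Taking c = 0 and b = 0 shows that P is a face of itself. *)
Definition face P F := F !=set0 /\
  exists (c : 'rV[R]_n) (b : R),
    (forall x, P x -> dotp c x <= b) /\ F = P `&` [set x | dotp c x = b].

Definition face_codim P F (k : nat) :=
  face P F /\ exists2 d, affine_dim (affine_span F) d & (d + k = n)%N.

End polytope.

Section lebesgue_cons.
Local Open Scope ereal_scope.
Context {R : realType} {n : nat}.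
Local Notation T := (measurableTypeR R).
Variable mu : {sigma_finite_measure set (n.-tuple T) -> \bar R}.

Definition pair_cons (p : T * n.-tuple T) : n.+1.-tuple T :=
  [the n.+1.-tuple T of p.1 :: p.2].

Lemma measurable_pair_cons : measurable_fun [set: T * n.-tuple T] pair_cons.
Proof. exact: (measurable_cons (f := fst) (g := snd)). Qed.

Let preimage_pair_cons (A : set (n.+1.-tuple T)) :
  measurable A -> measurable (pair_cons @^-1` A).
Proof. by move=> mA; rewrite -[X in measurable X]setTI; exact: measurable_pair_cons. Qed.

Definition lebesgue_cons : set (n.+1.-tuple T) -> \bar R :=
  pushforward (lebesgue_measure \x mu) pair_cons.

Let lebesgue_cons0 : lebesgue_cons set0 = 0.
Proof. by rewrite /lebesgue_cons /pushforward preimage_set0 measure0. Qed.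

Let lebesgue_cons_ge0 A : 0 <= lebesgue_cons A.
Proof. exact: (measure_ge0 (lebesgue_measure \x mu)). Qed.

Let lebesgue_cons_sigma_additive : semi_sigma_additive lebesgue_cons.
Proof.
move=> F mF tF mUF; rewrite /lebesgue_cons /pushforward preimage_bigcup.
apply: measure_semi_sigma_additive.
- by move=> i; exact: preimage_pair_cons.
- apply/trivIsetP => /= i j _ _ ij; rewrite -preimage_setI.
  by move/trivIsetP : tF => /(_ _ _ _ _ ij) ->//; rewrite preimage_set0.
- by rewrite -preimage_bigcup; exact: preimage_pair_cons.
Qed.

HB.instance Definition _ := isMeasure.Build _ _ _ lebesgue_cons
  lebesgue_cons0 lebesgue_cons_ge0 lebesgue_cons_sigma_additive.

Let lebesgue_cons_sigma_finite : sigma_finite [set: n.+1.-tuple T] lebesgue_cons.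
Proof.
pose uncons (t : n.+1.-tuple T) : T * n.-tuple T := (thead t, [tuple of behead t]).
have muncons : measurable_fun [set: n.+1.-tuple T] uncons.
  apply/measurable_fun_pairP; split; first exact: measurable_tnth.
  exact: measurable_behead.
have pair_consK : cancel pair_cons uncons.
  by move=> [x t]; congr pair; exact: val_inj.
have /sigma_finiteP[F [TF ndF Foo]] :=
  sigma_finiteT (@lebesgue_measure R : {sigma_finite_measure set T -> \bar R}).
have /sigma_finiteP[G [TG ndG Goo]] := sigma_finiteT mu.
exists (fun i => uncons @^-1` (F i `*` G i)).
  apply/seteqP; split => // t _; rewrite -preimage_bigcup /=.
  have [k _ Fk] : (\bigcup_k F k) (uncons t).1 by rewrite -TF.
  have [l _ Gl] : (\bigcup_l G l) (uncons t).2 by rewrite -TG.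
  exists (maxn k l) => //; split.
  - by apply: (subsetPset _ _ (ndF _ _ (leq_maxl k l))).
  - by apply: (subsetPset _ _ (ndG _ _ (leq_maxr k l))).
move=> i; have [mFi Fi] := Foo i; have [mGi Gi] := Goo i; split.
  by rewrite -[X in measurable X]setTI; apply: muncons => //; exact: measurableX.
rewrite /lebesgue_cons /pushforward (_ : _ @^-1` _ = F i `*` G i).
  by rewrite product_measure1E// lte_mul_pinfty// ge0_fin_numE.
by apply/funext => p; rewrite -[in RHS](pair_consK p).
Qed.

HB.instance Definition _ := Measure_isSigmaFinite.Build _ _ _ lebesgue_cons
  lebesgue_cons_sigma_finite.

End lebesgue_cons.

Section lebesgue_tuple.
Local Open Scope ereal_scope.
Context (R : realType).
Local Notation T := (measurableTypeR R).

Fixpoint lebesgue_tuple (n : nat) :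
    {sigma_finite_measure set (n.-tuple T) -> \bar R} :=
  match n with
  | 0 => \d_([tuple] : 0.-tuple T)
  | n'.+1 => lebesgue_cons (lebesgue_tuple n')
  end.

Lemma lebesgue_tuple_rectangle (n : nat) (A : 'I_n -> set T) :
  (forall i, measurable (A i)) ->
  lebesgue_tuple n [set t | forall i, A i (tnth t i)] =
  \prod_(i < n) lebesgue_measure (A i).
Proof.
elim: n A => [|n IHn] A mA.
  by rewrite big_ord0 /= diracE mem_set// => -[].
rewrite big_ord_recl -IHn; last by move=> i; exact: mA.
have mB : measurable [set t : n.-tuple T | forall i, A (lift ord0 i) (tnth t i)].
  rewrite (_ : mkset _ = \bigcap_(i in [set: 'I_n])
      (fun t : n.-tuple T => tnth t i) @^-1` A (lift ord0 i)).
    apply: fin_bigcap_measurable => // i _; rewrite -[X in measurable X]setTI.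
    have mtnth : measurable_fun [set: n.-tuple T] (@tnth n T ^~ i).
      exact: measurable_tnth.
    exact: mtnth.
  apply/seteqP; split => t At i; first by move=> _; exact: (At i).
  exact: (At i Logic.I).
rewrite -(product_measure1E lebesgue_measure (lebesgue_tuple n) (mA ord0) mB).
congr ((_ \x _)%E _); apply/seteqP; split => -[x t].
  move=> At; split => [|i]; first exact: (At ord0).
  by have := At (lift ord0 i); rewrite tnthS.
move=> [Ax At] i; have [j ->|->//] := unliftP ord0 i.
by rewrite tnthS; exact: At.
Qed.

End lebesgue_tuple.

(* Reading coordinates identifies 'rV[R]_n with n.-tuple R, the type on which
   the library puts the product sigma-algebra. *)
Definition volume {R : realType} {n : nat} (A : set 'rV[R]_n) : \bar R :=
  lebesgue_tuple R n [set t | A (\row_i tnth t i)].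

Lemma volume_rectangle {R : realType} {n : nat} (A : 'I_n -> set R) :
  (forall i, measurable (A i : set (measurableTypeR R))) ->
  volume [set v : 'rV[R]_n | forall i, A i (v 0 i)] =
  (\prod_(i < n) lebesgue_measure (A i))%E.
Proof.
move=> mA; rewrite -lebesgue_tuple_rectangle// /volume; congr (lebesgue_tuple _ _ _).
by apply/seteqP; split => t At i; have := At i; rewrite mxE.
Qed.

(* Main.v *)
Require Import Defs.
From HB Require Import structures.
From mathcomp Require Import all_boot all_order all_fingroup all_algebra.
From mathcomp Require Import all_classical all_reals all_analysis.
From mathcomp Require Import measurable_realfun ring lra.

Set Implicit Arguments.
Unset Strict Implicit.
Unset Printing Implicit Defensive.

Import Order.TTheory GRing.Theory Num.Theory.
Import numFieldNormedType.Exports.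

Local Open Scope classical_set_scope.
Local Open Scope ring_scope.

(** The proof is Rogers' decomposition into orthoscheme-like simplices, with the
    cube as the body of comparison.

    Assign to every face F of P the point c(F) of F nearest to the origin.  A
    flag P > F_1 > ... > F_n in which F_k has codimension at least k yields the
    simplex with vertices 0, c(F_1), ..., c(F_n).  These simplices cover P up to
    a null set, because the ray from c(F) through a point of F leaves F in a
    proper face of F ([face_path_cover]); and those of full dimension are
    disjoint once their vertices get positive weights ([face_path_inj]).

    For i <= k the point c(F_k) lies in F_i, so that the minimality of c(F_i)
    and the hypothesis on P give c(F_i).c(F_k) >= |c(F_i)|^2 >= i.  For the
    chain e_1, e_1 + e_2, e_1 + e_2 + e_3, ... of the cube all of these are
    equalities.  Hence the linear map that carries the simplex of the cube to
    the simplex of a flag never shortens a vector of the former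
    ([flag_far]), and a ball B about 0 fills a smaller proportion of the
    simplex of the flag than of the simplex T of the cube.  Summing over the
    flags, for a ball B inside P,
      vol B / vol P <= vol (T & B) / vol T.
    The 2^n n! images of T under the signed permutations of the coordinates
    tile [-1, 1]^n, so the right-hand side is at most vol B / 2^n, and
    vol P >= 2^n ([volume_ge_of_chains]).

    The only change of variables needed is that an invertible linear map
    multiplies all volumes by one and the same number, which is the uniqueness
    of translation invariant measures ([volume_preimage_mul_swap]). *)

(** * Translation invariance of Lebesgue measure *)

Section translation.
Context {R : realType}.
Local Notation T := (measurableTypeR R).

Lemma measurable_shift (a : R) : measurable_fun [set: T] (fun x : T => x + a : T).
Proof. by apply: measurable_funD. Qed.

Lemma lebesgue_measure_shift (a : R) (A : set T) : measurable A ->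
  lebesgue_measure [set x : R | A (x + a)] = lebesgue_measure A.
Proof.
move=> mA; pose f (x : T) : T := x + a.
have mf : measurable_fun [set: T] f by exact: measurable_shift.
pose f' : {mfun T >-> T} := HB.pack f (isMeasurableFun.Build _ _ _ _ _ mf).
apply/esym.
rewrite (@lebesgue_measure_unique R (pushforward lebesgue_measure f'))//.
move=> _ [[x y] _ <-] /=; rewrite /pushforward.
have -> : f @^-1` `]x, y] = `]x - a, y - a]%classic.
  by apply/seteqP; split => z /=; rewrite /f !in_itv/= ltrBlDr lerBrDr.
rewrite !lebesgue_measure_itv/= !lte_fin ltrD2r.
by case: ifPn => // _; rewrite -!EFinD opprB addrA subrK.
Qed.

Definition shift_tuple (n : nat) (a : 'I_n -> R) (t : n.-tuple T) : n.-tuple T :=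
  [tuple tnth t i + a i | i < n].

Lemma shift_pair_cons (n : nat) (a : 'I_n.+1 -> R) (x : T) (t : n.-tuple T) :
  shift_tuple a (pair_cons (x, t)) =
  pair_cons (x + a ord0 : T, shift_tuple (fun i => a (lift ord0 i)) t).
Proof.
apply: eq_from_tnth => i; rewrite tnth_mktuple.
by have [j ->|->//] := unliftP ord0 i; rewrite /pair_cons !tnthS/= tnth_mktuple.
Qed.

(** Slicing along the first coordinate reduces this, by induction, to the
    translation invariance of the line. *)
Lemma lebesgue_tuple_shift (n : nat) (a : 'I_n -> R) (A : set (n.-tuple T)) :
  measurable A ->
  lebesgue_tuple R n (shift_tuple a @^-1` A) =
  lebesgue_tuple R n A.
Proof.
elim: n a A => [|n IHn] a A mA.
  rewrite [X in lebesgue_tuple R 0 X = _](_ : _ = A)//.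
  by apply/funext => t /=; congr A; rewrite [LHS]tuple0 [RHS]tuple0.
pose B := @pair_cons R n @^-1` A.
have mB : measurable B.
  by rewrite -[X in measurable X]setTI; exact: measurable_pair_cons.
pose mu := lebesgue_tuple R n.
pose phi x := mu (xsection B x).
have mphi : measurable_fun [set: T] phi by exact: measurable_fun_xsection.
transitivity (\int[lebesgue_measure]_(x in [set: T]) phi (x + a ord0)%R)%E.
  change (\int[@lebesgue_measure R]_x
    mu (xsection (@pair_cons R n @^-1`
      (shift_tuple a @^-1` A)) x) =
    \int[@lebesgue_measure R]_(x in [set: T]) phi (x + a ord0)%R)%E.
  apply: eq_integral => x _; rewrite /phi.
  rewrite -(IHn (fun i => a (lift ord0 i)) (xsection B (x + a ord0))); last first.
    exact: measurable_xsection.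
  congr (mu _); apply/seteqP; split => t; rewrite /xsection /= !inE /B /=;
    by rewrite shift_pair_cons.
pose f (x : T) : T := x + a ord0.
have mf : measurable_fun [set: T] f by exact: measurable_shift.
pose f' : {mfun T >-> T} := HB.pack f (isMeasurableFun.Build _ _ _ _ _ mf).
transitivity (\int[pushforward lebesgue_measure f']_x phi x)%E.
  by rewrite ge0_integral_pushforward.
apply: eq_measure_integral => C mC _.
by rewrite /= /pushforward (lebesgue_measure_shift (a ord0)).
Qed.

End translation.

(** * Volume under linear maps *)

Section volume_linear.
Context {R : realType} {n : nat}.
Local Notation T := (measurableTypeR R).
Local Notation V := (lebesgue_tuple R n).
Implicit Types (A B : set 'rV[R]_n) (M : 'M[R]_n).

Definition row_of_tuple (t : n.-tuple T) : 'rV[R]_n := \row_i tnth t i.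

Definition tuple_of_row (x : 'rV[R]_n) : n.-tuple T := [tuple x 0 i | i < n].

Definition row_measurable A := measurable (row_of_tuple @^-1` A).

Lemma tuple_of_rowK : cancel tuple_of_row row_of_tuple.
Proof. by move=> x; apply/rowP => i; rewrite mxE tnth_mktuple. Qed.

Lemma measurable_preimage_row d (X : measurableType d) (g : X -> 'rV[R]_n) A :
  (forall j, measurable_fun [set: X] (fun x => g x 0 j : T)) ->
  row_measurable A -> measurable (g @^-1` A).
Proof.
move=> mg mA.
have mf : measurable_fun [set: X] (tuple_of_row \o g).
  apply/measurable_fun_tnthP => i.
  by rewrite (_ : _ \o _ = fun x => g x 0 i)//; apply/funext => x /=; rewrite tnth_mktuple.
have := mf measurableT _ mA; rewrite setTI.
by congr measurable; apply/funext => x /=; rewrite tuple_of_rowK.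
Qed.

Lemma measurable_row_mul d (X : measurableType d) (g : X -> 'rV[R]_n) M :
  (forall j, measurable_fun [set: X] (fun x => g x 0 j : T)) ->
  forall j, measurable_fun [set: X] (fun x => (g x *m M) 0 j : T).
Proof.
move=> mg j; under eq_fun do rewrite mxE.
by apply: measurable_sum => i; apply: measurable_funM => /=; [exact: (mg i)|exact: measurable_cst].
Qed.

Lemma measurable_row_of_tuple j :
  measurable_fun [set: n.-tuple T] (fun t => row_of_tuple t 0 j : T).
Proof.
by under eq_fun do rewrite mxE; exact: measurable_tnth.
Qed.

Lemma row_measurable_mul M A :
  row_measurable A -> row_measurable [set x | A (x *m M)].
Proof.
apply: (@measurable_preimage_row _ _ (fun t => row_of_tuple t *m M)).
by apply: measurable_row_mul; exact: measurable_row_of_tuple.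
Qed.

Lemma row_measurableI A B :
  row_measurable A -> row_measurable B -> row_measurable (A `&` B).
Proof. exact: measurableI. Qed.

Lemma row_measurable_le (f g : 'rV[R]_n -> R) :
  measurable_fun [set: n.-tuple T] (f \o row_of_tuple) ->
  measurable_fun [set: n.-tuple T] (g \o row_of_tuple) ->
  row_measurable [set x | f x <= g x].
Proof.
move=> mf mg; have := measurable_fun_ler mf mg measurableT (Y := [set true]).
by rewrite setTI; apply.
Qed.

Lemma row_measurable_lt (f g : 'rV[R]_n -> R) :
  measurable_fun [set: n.-tuple T] (f \o row_of_tuple) ->
  measurable_fun [set: n.-tuple T] (g \o row_of_tuple) ->
  row_measurable [set x | f x < g x].
Proof.
move=> mf mg; have := measurable_fun_ltr mf mg measurableT (Y := [set true]).
by rewrite setTI; apply.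
Qed.

Lemma row_measurable_bigcap (K : finType) (F : K -> set 'rV[R]_n) :
  (forall i, row_measurable (F i)) -> row_measurable [set x | forall i, F i x].
Proof.
move=> mF; rewrite /row_measurable.
rewrite (_ : _ @^-1` _ = \bigcap_(i in [set: K]) (row_of_tuple @^-1` F i)).
  by apply: fin_bigcap_measurable => // i _; exact: mF.
by apply/seteqP; split => t /= H i; [move=> _; exact: (H i)|exact: (H i Logic.I)].
Qed.

Lemma row_measurable_box (D : 'I_n -> set R) :
  (forall i, measurable (D i : set T)) ->
  row_measurable [set x | forall i, D i (x 0 i)].
Proof.
move=> mD; apply: row_measurable_bigcap => i.
have := measurable_row_of_tuple i measurableT (mD i).
by rewrite setTI.
Qed.

Lemma volume_shift (a : 'rV[R]_n) A : row_measurable A ->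
  volume [set x | A (x + a)] = volume A.
Proof.
move=> mA; rewrite -[RHS](lebesgue_tuple_shift (fun i => a 0 i)) //.
congr (V _); apply/funext => t /=; congr A.
by apply/rowP => i; rewrite !mxE tnth_mktuple.
Qed.

Let int_section (D : set (n.-tuple T * n.-tuple T)) : measurable D ->
  (\int[V]_x V (xsection D x) = \int[V]_y V (ysection D y))%E.
Proof.
move=> mD; have := indic_fubini_tonelli V V mD.
by rewrite indic_fubini_tonelli_FE// indic_fubini_tonelli_GE.
Qed.

Let int_indic (A : set (n.-tuple T)) (c : \bar R) : measurable A -> (0 <= c)%E ->
  (\int[V]_x (c * (\1_A x)%:E) = V A * c)%E.
Proof.
move=> mA c0; rewrite ge0_integralZl//.
  by rewrite integral_indic// setIT muleC.
by apply/measurable_EFinP; exact: measurable_indic.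

Qed.

(** This is the classical proof that translation invariant measures are
    proportional.  The left-hand side is the double integral over (x, y) of
    1_A(xM) 1_B(y); replacing y by y + xM, exchanging the integrals, and then
    replacing xM by xM - y turns it into that of 1_A(xM - y) 1_B(xM), which is
    the right-hand side. *)
Lemma volume_preimage_mul_swap M A B : M \in unitmx ->
  row_measurable A -> row_measurable B ->
  (volume [set x | A (x *m M)] * volume B =
   volume [set x | B (x *m M)] * volume [set x | A (- x)%R])%E.
Proof.
move=> uM mA mB.
pose r := row_of_tuple.
have mr1 j : measurable_fun [set: n.-tuple T * n.-tuple T] (fun p => (r p.1 *m M) 0 j : T).
  apply: measurable_row_mul => i.
  by apply: (measurableT_comp (measurable_row_of_tuple i)).
have mr2 j : measurable_fun [set: n.-tuple T * n.-tuple T] (fun p => r p.2 0 j : T).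
  by apply: (measurableT_comp (measurable_row_of_tuple j)).
pose D1 : set (n.-tuple T * n.-tuple T) :=
  [set p | A (r p.1 *m M) /\ B (r p.2 + r p.1 *m M)].
pose D2 : set (n.-tuple T * n.-tuple T) :=
  [set p | A (r p.1 *m M - r p.2) /\ B (r p.1 *m M)].
have mD1 : measurable D1.
  apply: measurableI; first exact: (measurable_preimage_row mr1).
  apply: (measurable_preimage_row (g := fun p => r p.2 + r p.1 *m M)) => // j.
  rewrite (_ : (fun _ => _) = (fun p => r p.2 0 j) \+ (fun p => (r p.1 *m M) 0 j)).
    exact: (measurable_funD (mr2 j) (mr1 j)).
  by apply/funext => p; rewrite mxE.
have mD2 : measurable D2.
  apply: measurableI; last exact: (measurable_preimage_row mr1).
  apply: (measurable_preimage_row (g := fun p => r p.1 *m M - r p.2)) => // j.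
  rewrite (_ : (fun _ => _) = (fun p => (r p.1 *m M) 0 j) \- (fun p => r p.2 0 j)).
    exact: (measurable_funB (mr1 j) (mr2 j)).
  by apply/funext => p; rewrite [LHS]mxE [X in _ + X]mxE.
have mAN : row_measurable [set x | A (- x)%R].
  rewrite (_ : mkset _ = [set x | A (x *m - 1%:M)]); first exact: row_measurable_mul.
  by apply/funext => x /=; rewrite mulmxN mulmx1.
have e1 : (\int[V]_x V (xsection D1 x) = volume [set x | A (x *m M)] * volume B)%E.
  rewrite -int_indic//; last exact: row_measurable_mul.
  apply: eq_integral => x _; rewrite indicE.
  have [|] := boolP (x \in _); rewrite ?inE ?notin_setE => Ax.
    rewrite mule1 -(volume_shift (r x *m M))//; congr (V _).
    by apply/seteqP; split=> y; rewrite /xsection /= inE /D1 /=; [case|split].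
  rewrite mule0 (_ : xsection D1 x = set0) ?measure0//.
  by apply/seteqP; split=> y; rewrite /xsection /= inE /D1 //= => -[].
have e2 : (\int[V]_x V (xsection D2 x) =
    volume [set x | B (x *m M)] * volume [set x | A (- x)%R])%E.
  rewrite -int_indic//; last exact: row_measurable_mul.
  apply: eq_integral => x _; rewrite indicE.
  have [|] := boolP (x \in _); rewrite ?inE ?notin_setE => Ax.
    rewrite mule1 -(volume_shift (- (r x *m M)))//; congr (V _).
    apply/seteqP; split=> y; rewrite /xsection /= inE /D2 /= opprD opprK addrC.
      by case.
    by split.
  rewrite mule0 (_ : xsection D2 x = set0) ?measure0//.
  by apply/seteqP; split=> y; rewrite /xsection /= inE /D2 //= => -[].
rewrite -e1 -e2 !int_section//; apply: eq_integral => y _.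
have mE : row_measurable [set x | A (x *m M - r y) /\ B (x *m M)].
  have := measurable_ysection y mD2; rewrite /row_measurable.
  by congr measurable; apply/seteqP; split => x; rewrite /ysection /= inE.
rewrite (_ : ysection D2 y =
  row_of_tuple @^-1` [set x | A (x *m M - r y) /\ B (x *m M)]); last first.
  by apply/seteqP; split => x; rewrite /ysection /= inE.
rewrite -[RHS](volume_shift (r y *m invmx M) mE); congr (V _).
by apply/seteqP; split => x; rewrite /ysection /= inE /D1 /= mulmxDl mulmxKV// addrK addrC.
Qed.

Definition unit_cube : set 'rV[R]_n := [set x | forall i, `[0, 1]%classic (x 0 i)].

Lemma volume_unit_cube : volume unit_cube = 1%E.
Proof.
rewrite (@volume_rectangle R n (fun=> `[0, 1]%classic))//.
by rewrite big1// => i _; rewrite lebesgue_measure_itv/= lte_fin ltr01 oppr0 adde0.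
Qed.

Lemma row_measurable_unit_cube : row_measurable unit_cube.
Proof. exact: (@row_measurable_box (fun=> `[0, 1]%classic)). Qed.

Lemma volume_opp A : row_measurable A -> volume [set x | A (- x)] = volume A.
Proof.
move=> mA; have := volume_preimage_mul_swap (unitmx1 _ _) mA row_measurable_unit_cube.
rewrite (_ : [set x | A (x *m 1%:M)] = A); last first.
  by apply/funext => x /=; rewrite mulmx1.
rewrite (_ : [set x | unit_cube (x *m 1%:M)] = unit_cube); last first.
  by apply/funext => x /=; rewrite mulmx1.
by rewrite volume_unit_cube mule1 mul1e => ->.
Qed.

Lemma volume_ge0 A : row_measurable A -> (0 <= volume A)%E.
Proof. by move=> mA; exact: measure_ge0. Qed.

Lemma volume_preimage_mulE M A : M \in unitmx -> row_measurable A ->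
  volume [set x | A (x *m M)] =
  (volume [set x | unit_cube (x *m M)] * volume A)%E.
Proof.
move=> uM mA; rewrite -[in RHS](volume_opp mA).
rewrite -(volume_preimage_mul_swap uM mA row_measurable_unit_cube).
by rewrite volume_unit_cube mule1.
Qed.

Lemma image_mul_unit M A : M \in unitmx ->
  [set x *m M | x in A] = [set x | A (x *m invmx M)].
Proof.
move=> uM; apply/seteqP; split => [_ [x Ax <-]|x Ax] /=; first by rewrite mulmxK.
by exists (x *m invmx M) => //; rewrite mulmxKV.
Qed.

Lemma row_measurable_image_mul M A : M \in unitmx -> row_measurable A ->
  row_measurable [set x *m M | x in A].
Proof. by move=> uM mA; rewrite image_mul_unit//; exact: row_measurable_mul. Qed.

(** The volume of the image of the unit cube, that is |det M|. *)
Definition linear_scale M : R := fine (volume [set x | unit_cube (x *m invmx M)]).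

(** The scales of M and of its inverse have product 1, hence both are positive
    and finite. *)
Lemma linear_scaleP M : M \in unitmx -> 0 < linear_scale M /\
  forall A, row_measurable A ->
    volume [set x *m M | x in A] = ((linear_scale M)%:E * volume A)%E.
Proof.
move=> uM; have uV : invmx M \in unitmx by rewrite unitmx_inv.
have mC N := row_measurable_mul N row_measurable_unit_cube.
set k := volume [set x | unit_cube (x *m invmx M)].
have k_ge0 : (0 <= k)%E by apply: volume_ge0; exact: mC.
have := volume_preimage_mulE uV (mC M).
rewrite [X in volume X](_ : _ = unit_cube); last first.
  by apply/funext => x /=; rewrite mulmxKV.
rewrite volume_unit_cube -/k => kV.
have l_ge0 := volume_ge0 (mC M).
have [k' k'_gt0 kE] : exists2 k' : R, 0 < k' & k = k'%:E.
  move: kV k_ge0 l_ge0; case: k => [k'| |] // kV.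
    rewrite lee_fin le_eqVlt => /orP[/eqP k0|k'0 _]; last by exists k'.
    by move: kV; rewrite -k0 mul0e => /eqP; rewrite eqe oner_eq0.
  move=> _ l0; move: kV; have [->|l_neq0] := eqVneq (volume [set x | unit_cube (x *m M)]) 0%E.
    by rewrite mule0 => /eqP; rewrite eqe oner_eq0.
  by rewrite gt0_mulye// lt_neqAle eq_sym l_neq0.
rewrite /linear_scale -/k kE; split=> // A mA.
by rewrite image_mul_unit// volume_preimage_mulE// -/k kE.
Qed.

(** An invertible change of coordinates sends the row space into a coordinate
    hyperplane, which is a null box. *)
Lemma singular_rowspace_null M : M \notin unitmx ->
  exists H, [/\ row_measurable H, volume H = 0%E & forall x, H (x *m M)].
Proof.
move=> sM; have r_lt : (\rank M < n)%N.
  by rewrite ltn_neqAle rank_leq_row andbT; move: sM; rewrite -row_free_unit.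
have n_gt0 : (0 < n)%N by exact: leq_ltn_trans r_lt.
have n0 : (n.-1 < n)%N by rewrite prednK.
pose j := Ordinal n0; pose N := invmx (row_ebase M).
have uN : N \in unitmx by rewrite unitmx_inv row_ebase_unit.
pose D (i : 'I_n) : set R := if i == j then [set 0] else setT.
have mD i : measurable (D i : set T) by rewrite /D; case: ifP.
have mH := row_measurable_box mD.
exists [set x | forall i, D i ((x *m N) 0 i)]; split.
- exact: (row_measurable_mul N mH).
- rewrite (volume_preimage_mulE uN mH) (volume_rectangle mD) (bigD1 j)//=.
  by rewrite /D eqxx lebesgue_measure_set1 mul0e mule0.
move=> x i; rewrite /D; case: eqP => // -> /=.
rewrite -{1}(mulmx_ebase M) !mulmxA /N mulmxK ?row_ebase_unit// mxE big1// => k _.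
rewrite [X in _ * X]mxE; have [kj|kj] := eqVneq (k : nat) j; last by rewrite mulr0.
by rewrite kj /= ltnNge -ltnS prednK// r_lt mulr0.
Qed.

End volume_linear.

(** * Packings and coverings by linear images *)

Section sums_of_images.
Context {R : realType} {n : nat}.
Implicit Types (A P D : set 'rV[R]_n) (M : 'M[R]_n).

Lemma fsum_finType (K : finType) (F : K -> \bar R) :
  (\sum_(k \in [set: K]) F k = \sum_k F k)%E.
Proof.
rewrite [RHS]fsbig_seq ?index_enum_uniq// (_ : [set` _] = setT)//.
by apply/seteqP; split => k //= _; rewrite mem_index_enum.
Qed.

Lemma le_volume A P : row_measurable A -> row_measurable P -> A `<=` P ->
  (volume A <= volume P)%E.
Proof.
by move=> mA mP AP; apply: le_measure; rewrite ?inE//= => t; exact: AP.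
Qed.

Variables (K : finType) (C : K -> 'M[R]_n).
Hypothesis unitC : forall k, C k \in unitmx.

Let scale := \sum_k linear_scale (C k).

Let sum_scale D : row_measurable D ->
  (\sum_k volume [set x *m C k | x in D] = scale%:E * volume D)%E.
Proof.
move=> mD; rewrite -sumEFin ge0_sume_distrl; last first.
  by move=> k _; rewrite lee_fin ltW//; case: (linear_scaleP (unitC k)).
by apply: eq_bigr => k _; have [_ ->] := linear_scaleP (unitC k).
Qed.

(** This and [volume_covering] compare one number, the sum of the scales of the
    maps C k, with the volume of a packed and of a covered set.  Used for P and
    for the cube with the same D, they eliminate the volume of D. *)
Lemma volume_packing D P : row_measurable D -> row_measurable P ->
  (forall k x, D x -> P (x *m C k)) ->
  (forall k l x y, D x -> D y -> x *m C k = y *m C l -> k = l) ->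
  (scale%:E * volume D <= volume P)%E.
Proof.
move=> mD mP DP inj; rewrite -sum_scale// -fsum_finType.
rewrite -measure_fin_bigcup//=; first last.
- by move=> k _; exact: row_measurable_image_mul.
- by move=> k l _ _ [t [[x Dx xE] [y Dy yE]]]; apply: (inj _ _ x y); rewrite // xE.
apply: le_measure; rewrite ?inE//.
  by apply: fin_bigcup_measurable => // k _; exact: row_measurable_image_mul.
by move=> t [k _ [x Dx xE]]; rewrite /preimage /= -[X in P X]xE; exact: DP.
Qed.

(** The row spaces of singular matrices stand for the points that lie on the
    boundary of some simplex, or in a degenerate one. *)
Lemma volume_covering D A (L : finType) (N : L -> 'M[R]_n) :
  row_measurable D -> row_measurable A -> (forall l, N l \notin unitmx) ->
  (forall x, A x -> (exists k y, D y /\ x = y *m C k) \/ exists l y, x = y *m N l) ->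
  (volume A <= scale%:E * volume D)%E.
Proof.
move=> mD mA sN cov.
have [H HP] := choice (fun l => singular_rowspace_null (sN l)).
pose Z := \bigcup_(l in [set: L]) H l.
have mZ : row_measurable Z.
  rewrite /row_measurable preimage_bigcup.
  by apply: fin_bigcup_measurable => // l _; case: (HP l).
have Z0 : volume Z = 0%E.
  apply/eqP; rewrite eq_le volume_ge0// andbT.
  apply: (@le_trans _ _ (\sum_(l \in [set: L]) volume (H l))%E); last first.
    by rewrite fsbig1// => l _; case: (HP l).
  apply: content_sub_fsum => //; first exact: finite_finset.
    by move=> l _; case: (HP l).
pose U := \bigcup_(k in [set: K]) [set x *m C k | x in D].
have mU : row_measurable U.
  rewrite /row_measurable preimage_bigcup.
  by apply: fin_bigcup_measurable => // k _; exact: row_measurable_image_mul.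
rewrite -sum_scale// -fsum_finType.
apply: (@le_trans _ _ (volume U + volume Z)%E); last first.
  rewrite Z0 adde0; apply: content_sub_fsum => //; first exact: finite_finset.
    by move=> k _; exact: row_measurable_image_mul.
apply: le_trans (measureU2 _ mU mZ).
apply: le_measure; rewrite ?inE//; first exact: measurableU.
move=> t /cov[[k [y [Dy e]]]|[l [y e]]]; [left; exists k => //; by exists y|right].
by exists l => //; rewrite /row_of_tuple e; case: (HP l).
Qed.

End sums_of_images.

Section dot_product.
Context {R : realType} {n : nat}.
Implicit Types (x y z c : 'rV[R]_n).

Lemma dotpC x y : dotp x y = dotp y x.
Proof. by apply: eq_bigr => i _; rewrite mulrC. Qed.

Lemma dotpDl x y z : dotp (x + y) z = dotp x z + dotp y z.
Proof. by rewrite -big_split; apply: eq_bigr => i _; rewrite mxE mulrDl. Qed.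

Lemma dotpZl (a : R) x y : dotp (a *: x) y = a * dotp x y.
Proof. by rewrite mulr_sumr; apply: eq_bigr => i _; rewrite mxE mulrA. Qed.

Lemma dotpDr x y z : dotp z (x + y) = dotp z x + dotp z y.
Proof. by rewrite dotpC dotpDl !(dotpC z). Qed.

Lemma dotpZr (a : R) x y : dotp y (a *: x) = a * dotp y x.
Proof. by rewrite dotpC dotpZl (dotpC y). Qed.

Lemma dotpNl x y : dotp (- x) y = - dotp x y.
Proof. by rewrite -scaleN1r dotpZl mulN1r. Qed.

Lemma dotpNr x y : dotp y (- x) = - dotp y x.
Proof. by rewrite dotpC dotpNl dotpC. Qed.

Lemma dotp0l x : dotp 0 x = 0.
Proof. by rewrite -(scale0r 0) dotpZl mul0r. Qed.

Lemma dotp0r x : dotp x 0 = 0.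
Proof. by rewrite dotpC dotp0l. Qed.

Lemma dotp_suml (I : Type) (s : seq I) (P : pred I) (F : I -> 'rV[R]_n) x :
  dotp (\sum_(i <- s | P i) F i) x = \sum_(i <- s | P i) dotp (F i) x.
Proof. by elim/big_rec2: _ => [|i a b _ <-]; rewrite ?dotp0l ?dotpDl. Qed.

Lemma dotp_sumr (I : Type) (s : seq I) (P : pred I) (F : I -> 'rV[R]_n) x :
  dotp x (\sum_(i <- s | P i) F i) = \sum_(i <- s | P i) dotp x (F i).
Proof. by rewrite dotpC dotp_suml; apply: eq_bigr => i _; rewrite dotpC. Qed.

Lemma dotp_ge0 x : 0 <= dotp x x.
Proof. by apply: sumr_ge0 => i _; rewrite -expr2 sqr_ge0. Qed.

Lemma dotp_eq0 x : (dotp x x == 0) = (x == 0).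
Proof.
apply/eqP/eqP => [x0|->]; last exact: dotp0l.
apply/rowP => i; rewrite mxE.
have h (j : 'I_n) : 0 <= x 0 j * x 0 j by rewrite -expr2 sqr_ge0.
have /psumr_eq0P := x0.
by move=> /(_ (fun j _ => h j) i isT)/eqP; rewrite mulf_eq0 orbb => /eqP.
Qed.

Lemma mulmx_trE x y : x *m y^T = (dotp x y)%:M.
Proof.
by apply/rowP => i; rewrite !mxE ord1 eqxx mulr1n; apply: eq_bigr => j _; rewrite mxE.
Qed.

(** The matrix is the orthogonal projection onto the hyperplane. *)
Lemma hyperplane_singular c : c != 0 ->
  exists2 M : 'M[R]_n, M \notin unitmx & forall x, dotp x c = 0 -> x *m M = x.
Proof.
move=> c0; have cc : dotp c c != 0 by rewrite dotp_eq0.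
exists (1%:M - (dotp c c)^-1 *: (c^T *m c)); last first.
  move=> x xc; rewrite mulmxBr mulmx1 -scalemxAr mulmxA mulmx_trE xc.
  by rewrite -scalemx1 scale0r mul0mx scaler0 subr0.
apply/negP => uM; move/eqP: c0; apply.
rewrite -[c](mulmxK uM) mulmxBr mulmx1 -scalemxAr mulmxA mulmx_trE.
by rewrite mul_scalar_mx scalerA mulVf// scale1r subrr mul0mx.
Qed.

Lemma measurable_dotp :
  measurable_fun [set: n.-tuple (measurableTypeR R)]
    ((fun x => dotp x x) \o row_of_tuple).
Proof.
apply: measurable_sum => i.
by apply: measurable_funM; exact: measurable_row_of_tuple.
Qed.

(** The closed Euclidean ball, given by its squared radius. *)
Definition eball (r2 : R) : set 'rV[R]_n := [set x | dotp x x <= r2].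

Lemma row_measurable_eball (r2 : R) : row_measurable (eball r2).
Proof.
by apply: row_measurable_le; [exact: measurable_dotp|exact: measurable_cst].
Qed.

Lemma sqr_coord_le_dotp x i : x 0 i ^+ 2 <= dotp x x.
Proof.
rewrite /dotp (bigD1 i)//= expr2 lerDl; apply: sumr_ge0 => j _.
by rewrite -expr2 sqr_ge0.
Qed.

(** The ball lies between two boxes. *)
Lemma volume_eball (r2 : R) : 0 < r2 ->
  exists2 b : R, 0 < b & volume (eball r2) = b%:E.
Proof.
move=> r0; pose s := Num.sqrt r2; pose e := Num.sqrt (r2 / n.+1%:R).
have e0 : 0 < e by rewrite sqrtr_gt0 divr_gt0.
have sq : s ^+ 2 = r2 by rewrite sqr_sqrtr// ltW.
have s0 : 0 < s by rewrite sqrtr_gt0.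
have box (a : R) : 0 < a ->
    row_measurable [set x : 'rV[R]_n | forall i, `[- a, a]%classic (x 0 i)] /\
    volume [set x : 'rV[R]_n | forall i, `[- a, a]%classic (x 0 i)] = ((a *+ 2) ^+ n)%:E.
  move=> a0; split; first exact: (@row_measurable_box R n (fun=> `[- a, a]%classic)).
  rewrite (@volume_rectangle R n (fun=> `[- a, a]%classic))//.
  rewrite (eq_bigr (fun=> (a *+ 2)%:E)); last first.
    by move=> i _; rewrite lebesgue_measure_itv/= lte_fin gtrN// -EFinD opprK mulr2n.
  by rewrite prodEFin prodr_const card_ord.
have [mS vS] := box s s0; have [me ve] := box e e0.
have mB := row_measurable_eball r2.
have le1 : (volume (eball r2) <= ((s *+ 2) ^+ n)%:E)%E.
  rewrite -vS; apply: le_volume => // x Bx i /=; rewrite in_itv/= -ler_norml.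
  rewrite -(@ler_pXn2r _ 2)// ?nnegrE//; last exact: ltW.
  by rewrite real_normK ?num_real// sq (le_trans (sqr_coord_le_dotp x i)).
have le2 : (((e *+ 2) ^+ n)%:E <= volume (eball r2))%E.
  rewrite -ve; apply: le_volume => // x Bx; rewrite /eball /= /dotp.
  apply: (@le_trans _ _ (\sum_(i < n) e ^+ 2)).
    apply: ler_sum => i _; rewrite -expr2 -real_normK ?num_real// ler_pXn2r// ?nnegrE//.
      by rewrite ler_norml; have := Bx i; rewrite /= in_itv.
    exact: ltW.
  rewrite sumr_const card_ord sqr_sqrtr; last by rewrite divr_ge0// ltW.
  rewrite -[leLHS]mulr_natr -mulrA ler_piMr//; first exact: ltW.
  by rewrite mulrC ler_pdivrMr// mul1r ler_nat.
exists (fine (volume (eball r2))).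
  apply: fine_gt0; rewrite (lt_le_trans _ le2) ?lte_fin ?exprn_gt0 ?mulrn_wgt0//=.
  by rewrite (le_lt_trans le1)// ltry.
rewrite fineK// ge0_fin_numE; last exact: volume_ge0.
by rewrite (le_lt_trans le1)// ltry.
Qed.

End dot_product.

(** * The chains of the cube *)

Section cube.
Context {R : realType} {n : nat}.
Implicit Types (x y z : 'rV[R]_n).

(** Barycentric coordinates with respect to n points and the origin.  The weight
    of the origin may vanish; the other weights are positive, so that the
    simplices of different flags are disjoint. *)
Definition open_simplex : set 'rV[R]_n :=
  [set x | (forall i, 0 < x 0 i) /\ \sum_i x 0 i <= 1].

Lemma row_measurable_open_simplex : row_measurable open_simplex.
Proof.
apply: row_measurableI.
  apply: row_measurable_bigcap => i; apply: row_measurable_lt; first exact: measurable_cst.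
  exact: measurable_row_of_tuple.
apply: row_measurable_le; last exact: measurable_cst.
by apply: measurable_sum => i; exact: measurable_row_of_tuple.
Qed.

(** The rows are the partial sums of the standard basis: the points nearest to
    0 in the faces of one flag of the cube [-1, 1]^n.  The image of
    [open_simplex] consists of the x with 1 >= x_0 > x_1 > ... > 0. *)
Definition staircase : 'M[R]_n := \matrix_(i, j) (j <= i)%N%:R.

Lemma mul_staircase x j : (x *m staircase) 0 j = \sum_(i < n | (j <= i)%N) x 0 i.
Proof.
rewrite mxE [RHS]big_mkcond; apply: eq_bigr => i _.
by rewrite mxE; case: ifP => _; rewrite ?mulr1 ?mulr0.
Qed.

Lemma staircase_unit : staircase \in unitmx.
Proof.
rewrite unitmxE det_trig.
  by rewrite big1 ?unitr1// => i _; rewrite mxE leqnn.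
by apply/is_trig_mxP => i j ij; rewrite mxE leqNgt ij.
Qed.

Lemma open_simplex_staircase_gt0 x j : open_simplex x -> 0 < (x *m staircase) 0 j.
Proof.
move=> [x0 _]; rewrite mul_staircase (bigD1 j)//= ltr_pwDl//.
by apply: sumr_ge0 => i _; exact: ltW.
Qed.

Lemma open_simplex_staircase_lt x j k : open_simplex x ->
  ((x *m staircase) 0 j < (x *m staircase) 0 k) = (k < j)%N.
Proof.
move=> [x0 _]; have decr (a b : 'I_n) : (a < b)%N ->
    (x *m staircase) 0 b < (x *m staircase) 0 a.
  move=> ab; rewrite !mul_staircase (bigD1 a (leqnn a))/= addrC ltr_pwDr//.
  rewrite [leLHS]big_mkcond [leRHS]big_mkcond; apply: ler_sum => i _.
  case: ifP => bi; case: ifP => //; last by rewrite ltW.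
  rewrite (leq_trans (ltnW ab) bi)/= => /negbT; rewrite negbK => /eqP ia.
  by move: bi; rewrite ia leqNgt ab.
case: (ltngtP k j) => [/decr //|/decr/ltW|/val_inj ->]; last by rewrite ltxx.
by rewrite leNgt => /negbTE.
Qed.

Definition signed_perm : Type := 'S_n * {ffun 'I_n -> bool}.
HB.instance Definition _ := Finite.on signed_perm.

Definition signed_perm_mx (g : signed_perm) : 'M[R]_n :=
  perm_mx (g.1^-1)%g *m diag_mx (\row_j (-1) ^+ g.2 j).

Lemma mul_signed_perm_mx (g : signed_perm) x j :
  (x *m signed_perm_mx g) 0 j = (-1) ^+ g.2 j * x 0 (g.1 j).
Proof.
by rewrite mulmxA -col_permE mul_mx_diag !mxE mulrC.
Qed.

Lemma signed_perm_mx_unit g : signed_perm_mx g \in unitmx.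
Proof.
rewrite unitmx_mul unitmx_perm/= unitmxE det_diag unitfE; apply/prodf_neq0 => i _.
by rewrite mxE signr_eq0.
Qed.

Lemma dotp_signed_perm_mx g x :
  dotp (x *m signed_perm_mx g) (x *m signed_perm_mx g) = dotp x x.
Proof.
rewrite /dotp [RHS](reindex_inj (@perm_inj _ g.1)); apply: eq_bigr => j _.
by rewrite mul_signed_perm_mx mulrACA -expr2 sqrr_sign mul1r.
Qed.

(** The flags of the cube, one for each signed permutation. *)
Definition chain_mx (g : signed_perm) : 'M[R]_n := staircase *m signed_perm_mx g.

Lemma chain_mx_unit g : chain_mx g \in unitmx.
Proof. by rewrite unitmx_mul staircase_unit signed_perm_mx_unit. Qed.

(** A permutation is recovered from the order that it induces. *)
Lemma perm_rank (s : 'S_n) j : #|[set k : 'I_n | (s k < s j)%N]%SET| = s j.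
Proof.
rewrite -(card_imset _ (@perm_inj _ s)).
rewrite (_ : _ @: _ = [set i : 'I_n | (i < s j)%N]%SET); last first.
  apply/setP => i; rewrite inE; apply/imsetP/idP => [[k + ->]|ij]; first by rewrite inE.
  by exists ((s^-1)%g i); rewrite ?inE permKV.
rewrite cardsE -sum1_card (big_ord_narrow (ltnW (ltn_ord (s j))))/=.
by rewrite sum1_card card_ord.
Qed.

(** The signs of a point of a simplex of the cube give the signs of its flag,
    and the order of the absolute values gives the permutation. *)
Lemma chain_mx_inj g h x y : open_simplex x -> open_simplex y ->
  x *m chain_mx g = y *m chain_mx h -> g = h.
Proof.
move=> Dx Dy; rewrite /chain_mx (mulmxA x) (mulmxA y) => e.
set u := x *m staircase in e; set v := y *m staircase in e.
pose z := u *m signed_perm_mx g.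
have zg j : z 0 j = (-1) ^+ g.2 j * u 0 (g.1 j) by rewrite mul_signed_perm_mx.
have zh j : z 0 j = (-1) ^+ h.2 j * v 0 (h.1 j) by rewrite /z e mul_signed_perm_mx.
have u0 j : 0 < u 0 j by exact: open_simplex_staircase_gt0.
have v0 j : 0 < v 0 j by exact: open_simplex_staircase_gt0.
have ng j : `|z 0 j| = u 0 (g.1 j) by rewrite zg normrMsign gtr0_norm.
have nh j : `|z 0 j| = v 0 (h.1 j) by rewrite zh normrMsign gtr0_norm.
have sgn (b : bool) (a : R) : 0 < a -> b = ((-1) ^+ b * a < 0).
  by move=> a0; case: b; rewrite ?expr1 ?expr0 ?mulN1r ?mul1r ?oppr_lt0 ?a0// ltNge ltW.
have permE (s s' : 'S_n) : (forall j, u 0 (s j) = v 0 (s' j)) -> s = s'.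
  move=> uv; apply/permP => j; apply/val_inj; rewrite /= -[LHS]perm_rank -[RHS]perm_rank.
  congr #|pred_of_set _|; apply/setP => k; rewrite !inE.
  by rewrite -(open_simplex_staircase_lt _ _ Dx) -(open_simplex_staircase_lt _ _ Dy) !uv.
have e1 : g.1 = h.1 by apply: permE => j; rewrite -ng nh.
have e2 : g.2 = h.2.
  apply/ffunP => j.
  by rewrite (sgn (g.2 j) _ (u0 (g.1 j))) (sgn (h.2 j) _ (v0 (h.1 j))) -zg zh.
by rewrite (surjective_pairing g) (surjective_pairing h) e1 e2.
Qed.

Definition generic_cube_point z :=
  [/\ forall j, `|z 0 j| <= 1, forall j, z 0 j != 0 &
      injective (fun j => `|z 0 j|)].

(** The weights are the successive differences of the coordinates. *)
Lemma open_simplex_preimage (t : 'rV[R]_n) : (forall j, 0 < t 0 j <= 1) ->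
  (forall j k : 'I_n, (j < k)%N -> t 0 k < t 0 j) ->
  exists2 x, open_simplex x & t = x *m staircase.
Proof.
move=> t01 decr.
pose f (i : nat) : R := if insub i is Some j then t 0 j else 0.
have fE (j : 'I_n) : f j = t 0 j by rewrite /f valK.
have fn : f n = 0 by rewrite /f insubN// ltnn.
pose x : 'rV[R]_n := \row_i (f i - f i.+1).
have sumE (j : nat) : (j <= n)%N -> \sum_(i < n | (j <= i)%N) x 0 i = f j.
  move=> jn; under eq_bigr do rewrite mxE.
  transitivity (\sum_(j <= i < n) (f i - f i.+1)).
    by rewrite (big_nat_widenl j 0%N)// big_mkord.
  have -> : f j = f j - f n by rewrite fn subr0.
  rewrite -[LHS]opprK -sumrN.
  by under eq_bigr do rewrite opprB; rewrite telescope_sumr// opprB.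
exists x.
  split=> [i|].
    rewrite mxE subr_gt0 fE /f; case: insubP => [k _ ki|_]; last by case/andP: (t01 i).
    by apply: decr; rewrite ki.
  have := sumE 0 (leq0n n); rewrite (eq_bigl xpredT)// => ->.
  by rewrite /f; case: insubP => [k _ _|_]; [case/andP: (t01 k)|exact: ler01].
by apply/rowP => j; rewrite mul_staircase sumE ?fE// ltnW.
Qed.

(** Sorting the coordinates by decreasing absolute value finds the simplex. *)
Lemma chain_mx_cover z : generic_cube_point z ->
  exists g x, open_simplex x /\ z = x *m chain_mx g.
Proof.
move=> [z1 z0 zinj].
(* The rank of a coordinate is the number of coordinates larger in absolute
   value; the ranks are distinct because the absolute values are. *)
pose above j := [set k : 'I_n | `|z 0 j| < `|z 0 k|]%SET.
have above_lt j k : `|z 0 j| < `|z 0 k| -> (#|above k| < #|above j|)%N.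
  move=> jk; apply: proper_card; apply/fintype.properP; split.
    by apply/fintype.subsetP => l; rewrite !inE; exact: lt_trans.
  by exists k; rewrite !inE ?ltxx.
have rank_lt j : (#|above j| < n)%N.
  rewrite -[X in (_ < X)%N]card_ord -cardsT; apply: proper_card.
  by apply/fintype.properP; split; [exact: finset.subsetT|exists j; rewrite !inE ?ltxx].
have rank_inj : injective (fun j => Ordinal (rank_lt j)).
  move=> j k /(congr1 val)/= jk; apply: zinj.
  by apply/eqP; case: ltgtP => // /above_lt; rewrite jk ltnn.
pose s := perm rank_inj.
have decr (j k : 'I_n) : (s j < s k)%N -> `|z 0 k| < `|z 0 j|.
  rewrite !permE /=; case: (ltgtP `|z 0 k| `|z 0 j|) => // [/above_lt|/zinj ->].
    by move=> a /(ltn_trans a); rewrite ltnn.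
  by rewrite ltnn.
pose t : 'rV[R]_n := \row_i `|z 0 ((s^-1)%g i)|.
have [||x Dx tE] := @open_simplex_preimage t.
- by move=> j; rewrite mxE normr_gt0 z0 z1.
- by move=> j k jk; rewrite !mxE; apply: decr; rewrite !permKV.
exists (s, [ffun j => z 0 j < 0]), x; split=> //.
apply/rowP => j; rewrite /chain_mx mulmxA -tE mul_signed_perm_mx/= ffunE mxE permK.
by rewrite mulr_sign_norm.
Qed.

Lemma chain_packing (r2 : R) :
  ((\sum_g linear_scale (chain_mx g))%:E *
     volume (open_simplex `&` [set x | eball r2 (x *m staircase)]) <=
   volume (eball r2 : set 'rV[R]_n))%E.
Proof.
apply: (volume_packing chain_mx_unit).
- apply: row_measurableI; first exact: row_measurable_open_simplex.
  by apply: row_measurable_mul; exact: row_measurable_eball.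
- exact: row_measurable_eball.
- by move=> g x [_]; rewrite /eball /= mulmxA dotp_signed_perm_mx.
- by move=> g h x y [Dx _] [Dy _]; exact: chain_mx_inj.
Qed.

Lemma chain_covering :
  ((2 ^+ n)%:E <=
   (\sum_g linear_scale (chain_mx g))%:E * volume open_simplex)%E.
Proof.
pose cube : set 'rV[R]_n := [set x | forall i, `[- 1, 1]%classic (x 0 i)].
have vcube : volume cube = (2 ^+ n)%:E.
  rewrite (@volume_rectangle R n (fun=> `[- 1, 1]%classic))//.
  rewrite (eq_bigr (fun=> 2%:E)); last first.
    by move=> i _; rewrite lebesgue_measure_itv/= lte_fin gtrN// -EFinD opprK.
  by rewrite prodEFin prodr_const card_ord.
rewrite -vcube.
pose d j : 'rV[R]_n := delta_mx 0 j.
have dotd x j : dotp x (d j) = x 0 j.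
  rewrite /dotp (bigD1 j)//= !mxE !eqxx mulr1 big1 ?addr0// => i ij.
  by rewrite mxE eqxx (negbTE ij) mulr0.
(* A point of the cube fails to be generic only on the hyperplanes x_j = 0 and
   x_j = x_k, x_j = - x_k; the diagonal j = k encodes the former. *)
pose c (l : 'I_n * 'I_n * bool) : 'rV[R]_n :=
  let: (j, k, b) := l in if j == k then d j else d j + (-1) ^+ b *: d k.
have c0 l : c l != 0.
  case: l => [[j k] b]; apply/eqP => /(congr1 (fun x : 'rV[R]_n => x 0 j)).
  rewrite /c; case: (eqVneq j k) => [_|jk]; rewrite !mxE !eqxx /=.
    by move/eqP; rewrite oner_eq0.
  by rewrite (negbTE jk) mulr0 addr0 => /eqP; rewrite oner_eq0.
have [N HN] := choice (fun l => let: ex_intro2 M sM HM := hyperplane_singular (c0 l) in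
  ex_intro (fun M => M \notin unitmx /\ forall x, dotp x (c l) = 0 -> x *m M = x) M (conj sM HM)).
apply: (volume_covering chain_mx_unit (N := N)).
- exact: row_measurable_open_simplex.
- exact: (@row_measurable_box R n (fun=> `[- 1, 1]%classic)).
- by move=> l; case: (HN l).
move=> x Cx; have [gx|ngx] := pselect (generic_cube_point x).
  by left; exact: chain_mx_cover.
right; suff [l xl] : exists l, dotp x (c l) = 0.
  by exists l, x; have [_ ->] := HN l.
apply: contra_notP ngx => /forallNP nl; split.
- by move=> j; rewrite ler_norml; have := Cx j; rewrite /= in_itv.
- by move=> j; apply/eqP => xj; apply: (nl (j, j, false)); rewrite /c eqxx dotd.
move=> j k /eqP; rewrite eqr_norm2 => xjk; apply/eqP/negPn/negP => jk.
case/orP: xjk => /eqP xjk.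
  apply: (nl (j, k, true)).
  by rewrite /c (negbTE jk) dotpDr dotpZr !dotd xjk expr1 mulN1r subrr.
apply: (nl (j, k, false)).
by rewrite /c (negbTE jk) dotpDr dotpZr !dotd xjk expr0 mul1r addNr.
Qed.

End cube.

Section comparison.
Context {R : realType} {n : nat}.

(** Write a and c for the sums of the scales over the simplices of the cube and
    over those of P, and D for the part of [open_simplex] that the staircase
    maps into the ball.  Packing the ball in the cube and covering it in P give
    a vol(D) <= vol(ball) <= c vol(D), so a <= c.  Covering the cube and packing
    P then give 2^n <= a vol(simplex) <= c vol(simplex) <= vol(P). *)
Lemma volume_ge_of_chains (P : set 'rV[R]_n) (r2 : R) (K L : finType)
    (C : K -> 'M[R]_n) (N : L -> 'M[R]_n) :
  row_measurable P -> 0 < r2 ->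
  (forall k, C k \in unitmx) -> (forall l, N l \notin unitmx) ->
  (forall k x, open_simplex x -> P (x *m C k)) ->
  (forall k l x y, open_simplex x -> open_simplex y ->
     x *m C k = y *m C l -> k = l) ->
  (forall k x, open_simplex x ->
     dotp (x *m staircase) (x *m staircase) <= dotp (x *m C k) (x *m C k)) ->
  (forall z, eball r2 z -> (exists k x, open_simplex x /\ z = x *m C k) \/
     exists l x, z = x *m N l) ->
  ((2 ^+ n)%:E <= volume P)%E.
Proof.
move=> mP r0 uC sN CP Cinj Cfar cov.
pose D := (@open_simplex R n) `&` [set x | eball r2 (x *m staircase)].
have mD : row_measurable D.
  apply: row_measurableI; first exact: row_measurable_open_simplex.
  by apply: row_measurable_mul; exact: row_measurable_eball.
have [b b0 bE] := @volume_eball R n _ r0.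
have pack1 := @chain_packing R n r2; have cov1 := @chain_covering R n.
have pack2 := volume_packing uC (@row_measurable_open_simplex R n) mP CP Cinj.
have cov2 : (volume (eball r2 : set 'rV[R]_n) <=
    (\sum_k linear_scale (C k))%:E * volume D)%E.
  apply: (volume_covering uC mD _ sN); first exact: row_measurable_eball.
  move=> z Bz; have [[k [x [Dx zE]]]|] := cov z Bz; last by right.
  left; exists k, x; split=> //; split=> //.
  by apply: le_trans (Cfar k x Dx) _; rewrite -zE.
rewrite bE in pack1 cov2.
apply: le_trans (le_trans cov1 _) pack2.
apply: lee_wpmul2r; first by apply: volume_ge0; exact: row_measurable_open_simplex.
set a := \sum_g _ in pack1 *; set c := \sum_k _ in cov2 *.
have vD0 : (0 <= volume D)%E by exact: volume_ge0.
have a0 : 0 <= a.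
  by apply: sumr_ge0 => g _; have [h _] := linear_scaleP (@chain_mx_unit R n g); exact: ltW.
have c0 : 0 <= c.
  by apply: sumr_ge0 => k _; have [h _] := linear_scaleP (uC k); exact: ltW.
rewrite -/D in pack1.
move: pack1 cov2 vD0; case: (volume D) => [v| |]//.
  rewrite -!EFinM !lee_fin => av cv v0.
  have {}v0 : 0 < v.
    by rewrite lt_neqAle v0 andbT; apply/eqP => v00; move: cv; rewrite -v00 mulr0 leNgt b0.
  by rewrite -(ler_pM2r v0); exact: le_trans cv.
move=> + _ _; rewrite lee_fin; have [-> _//|an0] := eqVneq a 0.
by rewrite gt0_muley ?lte_fin ?lt_neqAle 1?eq_sym ?an0.
Qed.

End comparison.

(** * Convex hulls of finitely many points *)

Section farkas.
Context {R : realType} {n : nat}.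
Implicit Types (s : seq 'rV[R]_n) (a x y l u : 'rV[R]_n).

(** The convex cone generated by a sequence, by recursion so that Farkas'
    alternative can be proved by induction on the generators. *)
Fixpoint cone s x : Prop :=
  if s is a :: s' then exists2 c : R, 0 <= c & cone s' (x - c *: a) else x = 0.

Lemma cone_shear (k : 'rV[R]_n -> R) a s x : {in s, forall e, 0 <= k e} ->
  cone [seq e + k e *: a | e <- s] x -> exists2 d : R, 0 <= d & cone s (x - d *: a).
Proof.
elim: s x => [x _ /= ->|e s IH x k0 [c c0 /IH[|d d0 conex]]].
- by exists 0; rewrite // scale0r subr0.
- by move=> e' e's; apply: k0; rewrite inE e's orbT.
exists (c * k e + d); first by rewrite addr_ge0// mulr_ge0// k0// mem_head.
exists c => //; move: conex; congr cone.
by apply/rowP => i; rewrite !mxE; ring.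
Qed.

(** Fourier-Motzkin elimination of the generator a.  If y separates x from the
    cone of the others but not from a, then all vectors are projected along a
    onto the hyperplane orthogonal to y: a separating functional of the
    projections, corrected by a multiple of y so as to vanish on a, separates
    the original vectors, and a conic combination of the projections lifts with
    nonnegative coefficient of a. *)
Lemma farkas s x : cone s x \/
  exists l, {in s, forall a, dotp l a <= 0} /\ 0 < dotp l x.
Proof.
have [k] := ubnP (size s); elim: k s x => // k IH [|a s] x /= sk.
  have [->|x0] := eqVneq x 0; first by left.
  by right; exists x; split=> //; rewrite lt_neqAle eq_sym dotp_eq0 x0 dotp_ge0.
have {}IH s' x' : size s' = size s -> cone s' x' \/
    exists l, {in s', forall a, dotp l a <= 0} /\ 0 < dotp l x'.
  by move=> s's; apply: IH; rewrite s's.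
have [cx|[y [ys yx]]] := IH s x erefl.
  by left; exists 0; rewrite // scale0r subr0.
have [ya|ya] := leP (dotp y a) 0.
  by right; exists y; split=> // e; rewrite inE => /predU1P[->//|/ys].
pose f e := - (dotp y e / dotp y a).
have [|cx|[l [ls lx]]] := IH [seq e + f e *: a | e <- s] (x + f x *: a).
- by rewrite size_map.
- left; have [|d d0 cxd] := cone_shear _ cx.
    by move=> e /ys ye; rewrite oppr_ge0 mulr_le0_ge0// invr_ge0 ltW.
  exists (d - f x); first by rewrite addr_ge0// opprK divr_ge0// ltW.
  by move: cxd; congr cone; apply/rowP => i; rewrite !mxE; ring.
right; exists (l - (dotp l a / dotp y a) *: y).
have wE e : dotp (l - (dotp l a / dotp y a) *: y) e = dotp l (e + f e *: a).
  by rewrite dotpDl dotpNl dotpZl dotpDr dotpZr /f; ring.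
split=> [e|]; last by rewrite wE.
rewrite inE => /predU1P[->|es]; last first.
  by rewrite wE ls//; apply/mapP; exists e.
by rewrite dotpDl dotpNl dotpZl divfK ?subrr// gt_eqF.
Qed.

Definition line_convex (Q : set 'rV[R]_n) :=
  forall x y (t : R), Q x -> Q y -> 0 <= t <= 1 -> Q ((1 - t) *: x + t *: y).

(** A direction in the cone spanned by the directions to points of a convex set
    can be followed for a positive time. *)
Lemma cone_feasible (Q : set 'rV[R]_n) s y u : line_convex Q -> Q y ->
  {in s, forall a, Q (y + a)} -> cone s u -> exists2 e : R, 0 < e & Q (y + e *: u).
Proof.
move=> cQ Qy; elim: s u => [|a s IH] u Qs /=.
  by move=> ->; exists 1; rewrite // scaler0 addr0.
move=> [c c0 /IH[|e e0 Qe]]; first by move=> b bs; apply: Qs; rewrite inE bs orbT.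
have d0 : 0 < 1 + c * e by rewrite ltr_pwDl// mulr_ge0// ltW.
exists (e / (1 + c * e)); first by rewrite divr_gt0.
have Qa : Q (y + a) by apply: Qs; exact: mem_head.
have := cQ _ _ (c * e / (1 + c * e)) Qe Qa.
rewrite divr_ge0 ?mulr_ge0 ?(ltW d0) ?(ltW e0)// ler_pdivrMr// mul1r lerDr ler01.
move=> /(_ isT); congr Q; apply/rowP => i; rewrite !mxE; field.
by rewrite gt_eqF.
Qed.

End farkas.

Lemma continuous_fun_sum (R : realType) (T : topologicalType) (I : finType)
    (f : I -> T -> R) :
  (forall i, continuous (f i)) -> continuous (fun x => \sum_i f i x).
Proof.
move=> cf x; apply: cvg_big => [|i _]; first exact: add_continuous.
exact: cf.
Qed.

Section hull.
Context {R : realType} {m n : nat}.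
Variable V : 'M[R]_(m, n).
Implicit Types (J : {set 'I_m}) (x y c u l : 'rV[R]_n) (a : 'rV[R]_m).
Local Notation v i := (row i V).

(** Weights supported on J are kept as vectors over all indices, so that the
    hulls of all vertex subsets are images under the same linear map. *)
Definition coefs J : set 'rV[R]_m :=
  [set a | [/\ forall i, 0 <= a 0 i, forall i, i \notin J -> a 0 i = 0 &
               \sum_i a 0 i = 1]].

Definition hull J : set 'rV[R]_n := [set a *m V | a in coefs J].

Lemma dotp_mul l a : dotp l (a *m V) = \sum_i a 0 i * dotp l (v i).
Proof.
by rewrite mulmx_sum_row dotp_sumr; apply: eq_bigr => i _; rewrite dotpZr.
Qed.

Lemma hull_convex J : line_convex (hull J).
Proof.
move=> _ _ t [a [a0 aJ a1] <-] [b [b0 bJ b1] <-] /andP[t0 t1].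
exists ((1 - t) *: a + t *: b); last by rewrite mulmxDl -!scalemxAl.
split=> [i|i iJ|].
- by rewrite !mxE addr_ge0// mulr_ge0// subr_ge0.
- by rewrite !mxE aJ// bJ// !mulr0 addr0.
under eq_bigr do rewrite !mxE.
by rewrite big_split -!mulr_sumr/= a1 b1 !mulr1 subrK.
Qed.

Lemma hull_vertex J i : i \in J -> hull J (v i).
Proof.
move=> iJ; exists (delta_mx 0 i); last by rewrite -rowE.
split=> [k|k kJ|]; rewrite ?mxE ?eqxx//=.
  by case: eqP kJ => // ->; rewrite iJ.
rewrite (bigD1 i)//= mxE !eqxx big1 ?addr0// => k ki.
by rewrite mxE (negbTE ki) andbF.
Qed.

Lemma hullS J J' : J \subset J' -> hull J `<=` hull J'.
Proof.
move=> /fintype.subsetP JJ' _ [a [a0 aJ a1] <-]; exists a => //; split=> // i.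
by move=> iJ'; apply: aJ; apply: contra iJ' => /JJ'.
Qed.

Lemma hull_nonempty J x : hull J x -> J != finset.set0.
Proof.
move=> [a [_ aJ a1] _]; apply/negP => /eqP J0.
move: a1; rewrite big1 => [/eqP|i _]; first by rewrite eq_sym oner_eq0.
by apply: aJ; rewrite J0 inE.
Qed.

Let gapE J l b a : coefs J a ->
  b - dotp l (a *m V) = \sum_i a 0 i * (b - dotp l (v i)).
Proof.
move=> [_ _ a1]; rewrite dotp_mul.
under [RHS]eq_bigr do rewrite mulrBr.
by rewrite sumrB -mulr_suml a1 mul1r.
Qed.

Let gap_ge0 J l b a : coefs J a -> {in J, forall i, dotp l (v i) <= b} ->
  forall i, 0 <= a 0 i * (b - dotp l (v i)).
Proof.
move=> [a0 aJ _] lb i; have [iJ|iJ] := boolP (i \in J); last by rewrite aJ// mul0r.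
by rewrite mulr_ge0// subr_ge0 lb.
Qed.

Lemma hull_le J l b x : {in J, forall i, dotp l (v i) <= b} -> hull J x ->
  dotp l x <= b.
Proof.
move=> lb [a aJ <-]; rewrite -subr_ge0 (gapE _ _ aJ).
by apply: sumr_ge0 => i _; exact: gap_ge0 aJ lb i.
Qed.

Lemma hull_eq J l b x : {in J, forall i, dotp l (v i) = b} -> hull J x ->
  dotp l x = b.
Proof.
move=> lb Jx; apply/eqP; rewrite eq_le (hull_le _ Jx) => [|i /lb->//].
by rewrite -lerN2 -dotpNl (hull_le _ Jx)// => i /lb; rewrite dotpNl => ->.
Qed.

(** A point where l is maximal puts no weight on vertices where l is smaller. *)
Lemma hull_face J l b x : {in J, forall i, dotp l (v i) <= b} -> hull J x ->
  dotp l x = b -> hull [set i in J | dotp l (v i) == b]%SET x.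
Proof.
move=> lb [a aJ <-] ab; exists a => //.
have [a0 aJ0 a1] := aJ; split=> // i; rewrite inE negb_and => /orP[/aJ0//|ib].
have [iJ|/aJ0//] := boolP (i \in J).
have /psumr_eq0P : \sum_i a 0 i * (b - dotp l (v i)) = 0.
  by rewrite -(gapE _ _ aJ) ab subrr.
move=> /(_ (fun j _ => gap_ge0 aJ lb j) i isT)/eqP.
by rewrite mulf_eq0 subr_eq0 [b == _]eq_sym (negbTE ib) orbF => /eqP.
Qed.

(** Split off one vertex at a time. *)
Lemma hull_sub_convex J (Q : set 'rV[R]_n) : line_convex Q ->
  {in J, forall i, Q (v i)} -> hull J `<=` Q.
Proof.
move=> cQ; have [k] := ubnP #|J|; elim: k J => // k IH J Jk QJ x Jx.
have /set0Pn[i iJ] := hull_nonempty Jx.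
have [a [a0 aJ a1] <-] := Jx.
have a_i : \sum_(j | j != i) a 0 j = 1 - a 0 i.
  by apply/eqP; rewrite eq_sym subr_eq -a1 [X in X == _](bigD1 i)//= addrC.
have ai1 : a 0 i <= 1 by rewrite -subr_ge0 -a_i sumr_ge0.
have [ai|ai] := eqVneq (a 0 i) 1.
  rewrite mulmx_sum_row (bigD1 i)//= ai scale1r big1 ?addr0; first exact: QJ.
  move=> j ji; have /psumr_eq0P : \sum_(j | j != i) a 0 j = 0 by rewrite a_i ai subrr.
  by move=> -> //; rewrite scale0r.
have d0 : 0 < 1 - a 0 i by rewrite subr_gt0 lt_neqAle ai ai1.
pose a' : 'rV[R]_m := \row_j (if j == i then 0 else a 0 j / (1 - a 0 i)).
have Qx' : Q (a' *m V).
  apply: (IH (J :\ i)%SET).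
  - by move: Jk; rewrite (cardsD1 i J) iJ.
  - by move=> j; rewrite !inE => /andP[_ /QJ].
  exists a' => //; split=> [j|j|].
  - by rewrite mxE; case: ifP => // _; rewrite divr_ge0// ltW.
  - rewrite mxE !inE negb_and negbK; case: ifP => //= _ /aJ ->.
    by rewrite mul0r.
  rewrite (bigD1 i)//= mxE eqxx add0r.
  under eq_bigr => j ji do rewrite mxE (negbTE ji).
  by rewrite -mulr_suml a_i divff// gt_eqF.
have := cQ _ _ (a 0 i) Qx' (QJ i iJ); rewrite a0 ai1 => /(_ isT).
congr Q; rewrite !mulmx_sum_row scaler_sumr [RHS](bigD1 i)//= addrC; congr (_ + _).
rewrite (bigD1 i)//= mxE eqxx scale0r scaler0 add0r; apply: eq_bigr => j ji.
by rewrite mxE (negbTE ji) scalerA mulrC divfK// gt_eqF.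
Qed.

Lemma continuous_dotp (k : 'rV[R]_m) : continuous (fun a : 'rV[R]_m => dotp a k : R).
Proof.
apply: continuous_fun_sum => i a.
apply: (@continuousM R 'rV[R]_m (fun a : 'rV[R]_m => a 0 i) (cst (k 0 i))).
  exact: coord_continuous.
exact: cst_continuous.
Qed.

Lemma coefs_compact J : compact (coefs J).
Proof.
pose box := [set a : 'rV[R]_m | forall i, `[0, 1]%classic (a 0 i)].
pose out := \bigcap_(i in [set i | i \notin J]) [set a : 'rV[R]_m | a 0 i = 0].
pose sum1 := [set a : 'rV[R]_m | dotp a (const_mx 1) = 1].
have dot1 a : dotp a (const_mx 1) = \sum_i a 0 i.
  by apply: eq_bigr => i _; rewrite mxE mulr1.
rewrite (_ : coefs J = box `&` (out `&` sum1)).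
  apply: compact_closedI.
    refine (@rV_compact R m (fun=> `[0, 1]%classic) _) => i.
    exact: segment_compact.
  apply: closedI.
    apply: closed_bigI => i _.
    apply: (@preimage_closed _ _ (fun a : 'rV[R]_m => a 0 i) [set 0]) => //.
    by move=> a _; exact: coord_continuous.
  apply: (@preimage_closed _ _ (fun a : 'rV[R]_m => dotp a (const_mx 1)) [set 1]) => //.
  by move=> a _; exact: continuous_dotp.
apply/seteqP; split=> a.
  move=> [a0 aJ a1]; split; last by split=> [i /aJ//|]; rewrite /sum1 /= dot1.
  move=> i /=; rewrite in_itv/= a0 -a1 (bigD1 i)//= lerDl.
  by apply: sumr_ge0 => j _.
move=> [abox [aout]]; rewrite /sum1 /= dot1 => a1; split=> // i.
by have := abox i; rewrite /= in_itv/= => /andP[].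
Qed.

Lemma hull_argmin J (f : 'rV[R]_m -> R) : J != finset.set0 -> continuous f ->
  exists2 a, coefs J a & forall b, coefs J b -> f a <= f b.
Proof.
move=> /set0Pn[i iJ] cf; have [a0 aJ _] := hull_vertex iJ.
have [] := @compact_EVT_min _ R f (coefs J) _ (@coefs_compact J).
- by exists a0.
- exact: continuous_subspaceT.
by move=> a /set_mem aJ' amin; exists a => // b /mem_set; exact: amin.
Qed.

Lemma continuous_dotp_mul : continuous (fun a : 'rV[R]_m => dotp (a *m V) (a *m V) : R).
Proof.
have E (a : 'rV[R]_m) j : (a *m V) 0 j = dotp a (\row_i V i j).
  by rewrite mxE; apply: eq_bigr => i _; rewrite mxE.
apply: continuous_fun_sum => j a.
apply: (@continuousM R 'rV[R]_m (fun a => (a *m V) 0 j) (fun a => (a *m V) 0 j));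
  rewrite (_ : (fun _ => _) = (fun a => dotp a (\row_i V i j))) ?funeqE//;
  exact: continuous_dotp.
Qed.

(** The point of the hull nearest to the origin, given by the variational
    inequality that it satisfies; its value for empty J is 0. *)
Definition nearest J : 'rV[R]_n :=
  xget 0 [set c | hull J c /\ forall x, hull J x -> dotp c c <= dotp c x].

(** If a minimizer c of the norm violated the inequality at x, then moving from
    c towards x would shorten it. *)
Lemma nearestP J : J != finset.set0 ->
  hull J (nearest J) /\
  forall x, hull J x -> dotp (nearest J) (nearest J) <= dotp (nearest J) x.
Proof.
move=> J0; rewrite /nearest; case: xgetP => //= nope; exfalso.
have [a aJ amin] := hull_argmin J0 continuous_dotp_mul.
pose c := a *m V; have Jc : hull J c by exists a.
apply: (nope c); split=> // x Jx; rewrite leNgt; apply/negP => cx.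
(* The derivative of |c + t w|^2 at 0 is - 2 d, so any t > 0 with t |w|^2 < 2 d
   decreases the norm. *)
pose d := dotp c c - dotp c x; have d0 : 0 < d by rewrite subr_gt0.
pose w := x - c; pose t := d / (d + dotp w w).
have ww : 0 <= dotp w w := dotp_ge0 w.
have dw : 0 < d + dotp w w by rewrite ltr_pwDl.
have t01 : 0 <= t <= 1.
  by rewrite divr_ge0 ?(ltW d0) ?(ltW dw)//= ler_pdivrMr// mul1r lerDl.
have [b bJ bE] := hull_convex Jc Jx t01.
have := amin b bJ; rewrite bE -/c.
rewrite (_ : (1 - t) *: c + t *: x = c + t *: w); last first.
  by rewrite /w scalerBr scalerBl scale1r addrA addrAC.
rewrite dotpDl !dotpDr !dotpZl !dotpZr leNgt => /negP; apply.
have cw : dotp c w = - d by rewrite /w dotpDr dotpNr /d opprB.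
have tdw : t * (d + dotp w w) = d by rewrite divfK// gt_eqF.
have t0 : 0 < t by rewrite divr_gt0.
rewrite (dotpC w c) cw; nra.
Qed.

Lemma nearest_set0 : nearest finset.set0 = 0.
Proof.
rewrite /nearest; case: xgetP => //= c _ [/hull_nonempty].
by rewrite eqxx.
Qed.

(** The ray from c in direction u has a last point y in the hull, by
    compactness.  If u were in the cone of the directions from y to the vertices,
    the ray could be prolonged; so Farkas' alternative yields a functional that
    is maximal at y and increases along u, that is a face at which the ray
    leaves. *)
Lemma hull_exit J c u : hull J c -> u != 0 ->
  exists t l b, [/\ 0 <= t, hull J (c + t *: u),
    forall s, hull J (c + s *: u) -> s <= t,
    {in J, forall i, dotp l (v i) <= b} &
    dotp l (c + t *: u) = b /\ 0 < dotp l u].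
Proof.
move=> Jc u0; have uu : 0 < dotp u u by rewrite lt_neqAle eq_sym dotp_eq0 u0 dotp_ge0.
pose adj l : 'rV[R]_m := \row_i dotp l (v i).
have adjE l a : dotp l (a *m V) = dotp a (adj l).
  by rewrite dotp_mul; apply: eq_bigr => i _; rewrite mxE.
(* The line through c in direction u is cut out by the functionals that vanish
   on u. *)
pose ray := coefs J `&` \bigcap_(w in [set w | dotp w u = 0])
  [set a | dotp a (adj w) = dotp w c].
have rayE a : ray a -> a *m V = c + (dotp u (a *m V - c) / dotp u u) *: u.
  move=> [aJ aw]; set s := _ / _; pose w := a *m V - c - s *: u.
  have wu : dotp w u = 0.
    by rewrite /w dotpDl dotpNl dotpZl /s divfK ?gt_eqF// dotpC subrr.
  have := aw w wu; rewrite /= -adjE => wac.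
  suff /eqP : dotp w w = 0.
    by rewrite dotp_eq0 => /eqP w0; apply/eqP; rewrite -subr_eq0 opprD addrA; apply/eqP.
  by rewrite {2}/w dotpDr dotpDr !dotpNr dotpZr wu wac mulr0 subrr subr0.
have [a0 a0J a0c] := Jc.
have ray_in s : hull J (c + s *: u) -> exists2 a, ray a & a *m V = c + s *: u.
  move=> [a aJ aE]; exists a => //; split=> // w /= wu.
  by rewrite -adjE aE dotpDr dotpZr wu mulr0 addr0.
have ray_compact : compact ray.
  apply: compact_closedI; first exact: coefs_compact.
  apply: closed_bigI => w _.
  apply: (@preimage_closed _ _ (fun a : 'rV[R]_m => dotp a (adj w)) [set dotp w c]) => //.
  by move=> a _; exact: continuous_dotp.
have [||a /set_mem ra amax] := @compact_EVT_max _ R (fun a => dotp a (adj u)) ray _ ray_compact.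
- have [|a ra _] := ray_in 0; first by rewrite scale0r addr0.
  by exists a.
- by apply: continuous_subspaceT; exact: continuous_dotp.
pose t := dotp u (a *m V - c) / dotp u u; pose y := c + t *: u.
have yE : a *m V = y by exact: rayE.
have Jy : hull J y by exists a => //; case: ra.
have tmax s : hull J (c + s *: u) -> s <= t.
  move=> /ray_in[b rb bE]; have /mem_set/amax := rb; rewrite -!adjE bE yE /y.
  by rewrite !dotpDr !dotpZr lerD2l ler_pM2r.
have t0 : 0 <= t by apply: tmax; rewrite scale0r addr0.
have [cu|[l [ly lu]]] := farkas [seq v i - y | i <- enum J] u; last first.
  exists t, l, (dotp l y); split=> // i iJ.
  have := ly (v i - y); rewrite dotpDr dotpNr subr_le0; apply.
  by apply/mapP; exists i; rewrite ?mem_enum.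
have [|e e0] := cone_feasible (@hull_convex J) Jy _ cu.
  by move=> _ /mapP[i + ->]; rewrite mem_enum subrKC => /hull_vertex.
by rewrite /y -addrA -scalerDl => /tmax; rewrite gerDl leNgt e0.
Qed.

End hull.

(** * Chains of faces *)

Section faces.
Context {R : realType} {m n : nat}.
Variable V : 'M[R]_(m, n).
Implicit Types (F J K : {set 'I_m}) (x y c u l : 'rV[R]_n).
Local Notation v i := (row i V).
Local Notation hull := (hull V).
Local Notation nearest := (nearest V).
Local Notation whole := (finset.setTfor 'I_m).

(** Faces are coded by the sets of vertices that they contain. *)
Definition supports l b J :=
  forall i, if i \in J then dotp l (v i) = b else dotp l (v i) < b.

Definition is_face J := J != finset.set0 /\ exists l b, supports l b J.

Lemma supports_le l b J i : supports l b J -> dotp l (v i) <= b.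
Proof. by move=> /(_ i); case: ifP => _ => [->//|/ltW]. Qed.

Lemma supports_eq l b J i : supports l b J -> i \in J -> dotp l (v i) = b.
Proof. by move=> /(_ i) + iJ; rewrite iJ. Qed.

Lemma supports_hull_le l b J x : supports l b J -> hull whole x -> dotp l x <= b.
Proof. by move=> lbJ; apply: hull_le => i _; exact: supports_le lbJ. Qed.

Lemma supports_hull l b J x : supports l b J -> hull whole x ->
  dotp l x = b -> hull J x.
Proof.
move=> lbJ Tx lx.
have := hull_face (fun i _ => supports_le i lbJ) Tx lx.
apply: hullS; apply/fintype.subsetP => i; rewrite !inE /=.
by have := lbJ i; case: ifP => // _ + /eqP lv; rewrite lv ltxx.
Qed.

Lemma supports_hull_lt l b J x : supports l b J -> hull whole x -> ~ hull J x ->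
  dotp l x < b.
Proof.
move=> lbJ Tx nJx; rewrite lt_neqAle (supports_hull_le lbJ Tx) andbT.
by apply/eqP => /(supports_hull lbJ Tx).
Qed.

Lemma hull_whole J x : hull J x -> hull whole x.
Proof. by apply: hullS; exact: finset.subsetT. Qed.

Lemma is_face_whole x : hull whole x -> is_face whole.
Proof.
move=> /hull_nonempty T0; split=> //; exists 0, 0 => i.
by rewrite inE dotp0l.
Qed.

(** A face of a face is a face: a large multiple of the functional that cuts out
    F, perturbed by l, cuts out the smaller face. *)
Lemma is_face_sub F l b : is_face F -> {in F, forall i, dotp l (v i) <= b} ->
  [set i in F | dotp l (v i) == b]%SET != finset.set0 ->
  is_face [set i in F | dotp l (v i) == b]%SET.
Proof.
move=> [_ [l0 [b0 sF]]] lb J0; split=> //.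
(* Off F the first functional has gap b0 - l0(v_i) > 0, which the factor k makes
   larger than the violation l(v_i) - b. *)
pose r i := `|(dotp l (v i) - b) / (b0 - dotp l0 (v i))|.
pose k := 1 + \sum_i r i.
exists (k *: l0 + l), (k * b0 + b) => i.
rewrite dotpDl dotpZl inE; case: ifP => [/andP[iF /eqP ->]|].
  by rewrite (supports_eq sF iF).
have [iF /= /negbT lvi|iF _] := boolP (i \in F).
  by rewrite (supports_eq sF iF) ltrD2l lt_neqAle lvi lb.
have gap : 0 < b0 - dotp l0 (v i) by have := sF i; rewrite (negbTE iF) subr_gt0.
rewrite -subr_gt0 (_ : _ - _ = k * (b0 - dotp l0 (v i)) - (dotp l (v i) - b)); last by ring.
rewrite subr_gt0; apply: (@le_lt_trans _ _ (r i * (b0 - dotp l0 (v i)))).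
  rewrite /r normrM normfV (gtr0_norm gap) divfK ?gt_eqF//.
  exact: ler_norm.
rewrite ltr_pM2r// /k (bigD1 i)//= addrCA ltrDl ltr_pwDl//.
by apply: sumr_ge0 => j _; exact: normr_ge0.
Qed.

(** The direction space of the affine span of the face J; taking the differences
    of all pairs avoids the choice of a base point. *)
Definition direction J : {vspace 'rV[R]_n} :=
  <<[seq v i - v k | i <- enum J, k <- enum J]>>%VS.

Lemma direction_vertex J i k : i \in J -> k \in J -> v i - v k \in direction J.
Proof.
move=> iJ kJ; apply: memv_span; apply/allpairsP; exists (i, k).
by rewrite !mem_enum.
Qed.

Lemma directionS J K : J \subset K -> (direction J <= direction K)%VS.
Proof.
move=> /fintype.subsetP JK; apply/span_subvP => _ /allpairsP[[i k] [/= + + ->]].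
by rewrite !mem_enum => /JK iK /JK kK; exact: direction_vertex.
Qed.

Lemma span_orthogonal (X : seq 'rV[R]_n) l w :
  {in X, forall e, dotp l e = 0} -> w \in <<X>>%VS -> dotp l w = 0.
Proof.
move=> lX wX; have := @coord_span _ _ _ (in_tuple X) w wX => ->.
rewrite dotp_sumr big1// => i _.
by rewrite dotpZr lX ?mulr0// mem_nth.
Qed.

Lemma direction_orthogonal J l b w : {in J, forall i, dotp l (v i) = b} ->
  w \in direction J -> dotp l w = 0.
Proof.
move=> lb; apply: span_orthogonal => _ /allpairsP[[i k] [/= + + ->]].
by rewrite !mem_enum => iJ kJ; rewrite dotpDr dotpNr !lb// subrr.
Qed.

Lemma hull_vertex_direction J x k : hull J x -> k \in J -> x - v k \in direction J.
Proof.
move=> [a [_ aJ a1] <-] kJ.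
rewrite mulmx_sum_row -[v k]scale1r -a1 scaler_suml -sumrB.
apply: memv_suml => i _; rewrite -scalerBr.
have [iJ|iJ] := boolP (i \in J); last by rewrite aJ// scale0r mem0v.
by apply: memvZ; exact: direction_vertex.
Qed.

Lemma hull_direction J x y : hull J x -> hull J y -> x - y \in direction J.
Proof.
move=> Jx Jy; have /set0Pn[k kJ] := hull_nonempty Jx.
rewrite -(subrKA (v k)); apply: memvD; first exact: hull_vertex_direction.
by rewrite -opprB memvN; exact: hull_vertex_direction.
Qed.

(** One step of a flag.  That the nearest point of F is left behind makes the
    inclusion strict, and holds for the faces through which rays from that
    point leave F. *)
Definition face_step F J :=
  `[< [/\ is_face J, J \subset F & ~ hull J (nearest F)] >].

(** The functional that cuts out J is constant on J, but not on F: it is smaller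
    at the nearest point of F. *)
Lemma face_step_dim F J : F != finset.set0 -> face_step F J ->
  (\dim (direction J) < \dim (direction F))%N.
Proof.
move=> F0 /asboolP[[J0 [l [b sJ]]] JF cJ].
rewrite ltn_neqAle dimvS ?directionS// andbT; apply/negP => /eqP dJF.
have [Fc _] := nearestP V F0; have /set0Pn[k kJ] := J0.
have Fk : hull F (v k) by apply: (hullS JF); exact: hull_vertex.
have := hull_direction Fc Fk.
have /eqP <- : direction J == direction F by rewrite eqEdim directionS//= dJF.
move=> /(direction_orthogonal (fun i => @supports_eq l b J i sJ)).
rewrite dotpDr dotpNr (supports_eq sJ kJ) => /eqP; rewrite subr_eq0 => /eqP lc.
exact: cJ (supports_hull sJ (hull_whole Fc) lc).
Qed.

Lemma face_path_faces F s J : path face_step F s -> J \in s ->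
  is_face J /\ J \subset F.
Proof.
elim: s F => //= K s IH F /andP[/asboolP[fK KF _] Ks].
rewrite inE => /predU1P[->//|/(IH _ Ks)[fJ JK]].
by split=> //; exact: fintype.subset_trans JK KF.
Qed.

Lemma face_path_nearest F s J : path face_step F s -> J \in s -> hull F (nearest J).
Proof.
move=> Fs Js; have [[J0 _] JF] := face_path_faces Fs Js.
by apply: (hullS JF); case: (nearestP V J0).
Qed.

Lemma face_path_dim F s i : F != finset.set0 -> path face_step F s ->
  (i < size s)%N ->
  (\dim (direction (nth finset.set0 s i)) + i < \dim (direction F))%N.
Proof.
move=> F0; elim: s F F0 i => // J s IH F F0 i /= /andP[FJ Js].
have dJ := face_step_dim F0 FJ; have /asboolP[[J0 _] _ _] := FJ.
case: i => [|i] /=; first by rewrite addn0.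
by rewrite ltnS => /(IH _ J0 _ Js) dn; rewrite addnS; exact: leq_ltn_trans dJ.
Qed.

(** Send a ray from the nearest point of F through x.  It leaves F in a face J
    of smaller dimension, and induction applies to its exit point y.  The
    weights are those of y scaled by the ratio 1 / t at which x divides the
    segment from the nearest point to y. *)
Lemma face_path_cover F x : is_face F -> hull F x ->
  exists s (a : nat -> R), [/\ path face_step F s, forall i, 0 <= a i,
    \sum_(i < (size s).+1) a i = 1 &
    x = \sum_(i < (size s).+1) a i *: nearest (nth finset.set0 (F :: s) i)].
Proof.
have [k] := ubnP (\dim (direction F)).
elim: k F x => // k IH F x dF fF Fx.
have F0 := fF.1; have [Fc _] := nearestP V F0; set c := nearest F in Fc *.
have [xc|xc] := eqVneq x c.
  by exists [::], (fun=> 1); split=> //; rewrite big_ord1// scale1r.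
have u0 : x - c != 0 by rewrite subr_eq0.
have [t [l [b [t0 Fy tmax lF [ly lu]]]]] := hull_exit Fc u0.
set y := c + t *: (x - c) in Fy ly.
have t1 : 1 <= t by apply: tmax; rewrite scale1r addrC subrK.
have t_gt0 : 0 < t by exact: lt_le_trans t1.
set J := [set i in F | dotp l (v i) == b]%SET.
have Jy : hull J y by exact: hull_face.
have fJ : is_face J by apply: is_face_sub => //; exact: hull_nonempty Jy.
have FJ : face_step F J.
  apply/asboolP; split=> //; first by apply/fintype.subsetP => i; rewrite inE => /andP[].
  move=> /(@hull_eq _ _ _ _ _ l b) lc.
  have := ly; rewrite /y dotpDr dotpZr lc => [/eqP|i].
    by rewrite -subr_eq0 addrAC subrr add0r mulf_eq0 !gt_eqF.
  by rewrite inE => /andP[_ /eqP].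
have dJ : (\dim (direction J) < k)%N.
  by rewrite -ltnS; apply: leq_trans dF; rewrite ltnS; exact: face_step_dim.
have [s [a [Js a0 a1 yE]]] := IH J y dJ fJ Jy.
exists (J :: s), (fun i => if i is i'.+1 then t^-1 * a i' else 1 - t^-1); split=> /=.
- by rewrite FJ.
- case=> [|i]; first by rewrite subr_ge0 invf_le1.
  by rewrite mulr_ge0// invr_ge0.
- by rewrite big_ord_recl/= -mulr_sumr a1 mulr1 subrK.
rewrite big_ord_recl /=; under eq_bigr do rewrite -scalerA.
rewrite -scaler_sumr -yE /y scalerDr scalerA mulVf ?gt_eqF// scale1r scalerBl.
by rewrite scale1r addrA subrK addrC subrK.
Qed.

(** The points nearest K, for K in J :: s, are independent and lie in J.  Their
    differences span a space of dimension size s inside the direction space of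
    J, hence all of it, and a functional constant on these points is constant
    on J. *)
Lemma face_determined J s l b :
  free [seq nearest K | K <- J :: s] ->
  {in J :: s, forall K, hull J (nearest K)} ->
  (\dim (direction J) <= size s)%N ->
  {in J :: s, forall K, dotp l (nearest K) = b} ->
  {in J, forall i, dotp l (v i) = b}.
Proof.
move=> fr inJ dJ lb i iJ.
pose D := <<[seq nearest K - nearest J | K <- s]>>%VS.
have JJ : J \in J :: s by exact: mem_head.
have sJ K : K \in s -> K \in J :: s by move=> Ks; rewrite inE Ks orbT.
have DJ : (D <= direction J)%VS.
  apply/span_subvP => _ /mapP[K Ks ->].
  by apply: hull_direction; apply: inJ => //; exact: sJ.
have sub : (<<[seq nearest K | K <- J :: s]>> <= <[nearest J]> + D)%VS.
  apply/span_subvP => _ /mapP[K + ->]; rewrite inE => /predU1P[->|Ks].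
    by apply: (subvP (addvSl _ _)); exact: memv_line.
  rewrite -(subrK (nearest J) (nearest K)) addrC; apply: memv_add; first exact: memv_line.
  by apply: memv_span; apply/mapP; exists K.
have dD : (size s <= \dim D)%N.
  have := dimvS sub; move: fr; rewrite /free => /eqP ->; rewrite size_map /= => le1.
  have := leq_trans le1 (dimv_add_leqif _ _).
  rewrite dim_vline => le2; rewrite -ltnS; apply: leq_trans le2 _.
  by rewrite -[(\dim D).+1]add1n leq_add2r leq_b1.
have DE : D = direction J by apply/eqP; rewrite eqEdim DJ (leq_trans dJ).
have := hull_direction (hull_vertex V iJ) (inJ _ JJ); rewrite -DE.
move=> /(@span_orthogonal _ l) lz.
have /eqP := lz (ltac:(move=> _ /mapP[K Ks ->]; rewrite dotpDr dotpNr !lb ?subrr//; exact: sJ)).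
by rewrite dotpDr dotpNr (lb _ JJ) subr_eq0 => /eqP.
Qed.

Lemma hull_head J s K : is_face J -> path face_step J s -> K \in J :: s ->
  hull J (nearest K).
Proof.
move=> [J0 _] Js; rewrite inE => /predU1P[->|Ks]; first by case: (nearestP V J0).
exact: face_path_nearest Js Ks.
Qed.

(** Evaluate at both sides the functional l of the face J, subtracting its value
    at the base point.  Each point of s contributes the maximal gain
    b - l(nearest F), each point of s' at most that; so the total weight of s is
    at most that of s', and if they agree every point of s' lies on J. *)
Lemma weight_compare F J (s s' : seq {set 'I_m}) (p q : nat -> R) l b :
  supports l b J -> hull whole (nearest F) -> ~ hull J (nearest F) ->
  {in s, forall K, hull J (nearest K)} ->
  {in s', forall K, hull whole (nearest K)} ->
  (forall i, 0 < q i) ->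
  \sum_(i < size s) p i *: (nearest (nth finset.set0 s i) - nearest F) =
  \sum_(i < size s') q i *: (nearest (nth finset.set0 s' i) - nearest F) ->
  \sum_(i < size s) p i <= \sum_(i < size s') q i /\
  (\sum_(i < size s') q i <= \sum_(i < size s) p i ->
   {in s', forall K, dotp l (nearest K) = b}).
Proof.
move=> sJ Tc cJ sJs Ts' q0 e; set c := nearest F in Tc cJ e.
have g0 : 0 < b - dotp l c by rewrite subr_gt0; exact: supports_hull_lt sJ Tc cJ.
pose gap i := q i * (b - dotp l (nearest (nth finset.set0 s' i))).
have gap_ge0 (i : 'I_(size s')) : 0 <= gap i.
  rewrite mulr_ge0 ?(ltW (q0 i))// subr_ge0 (supports_hull_le sJ)//.
  by apply: Ts'; rewrite mem_nth.
have key : (\sum_(i < size s) p i) * (b - dotp l c) + \sum_(i < size s') gap i =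
    (\sum_(i < size s') q i) * (b - dotp l c).
  have := congr1 (dotp l) e; rewrite !dotp_sumr.
  rewrite (eq_bigr (fun i : 'I_(size s) => p i * (b - dotp l c))); last first.
    move=> i _; rewrite dotpZr dotpDr dotpNr.
    rewrite (hull_eq (fun k => @supports_eq l b J k sJ))//.
    by apply: sJs; rewrite mem_nth.
  rewrite mulr_suml => ->; rewrite -big_split mulr_suml; apply: eq_bigr => i _.
  by rewrite /= dotpZr dotpDr dotpNr /gap; ring.
have S0 : 0 <= \sum_(i < size s') gap i by apply: sumr_ge0 => i _.
split; first by rewrite -(ler_pM2r g0) -key lerDl.
move=> qp K Ks'; have : \sum_(i < size s') gap i = 0.
  apply/eqP; rewrite eq_le S0 andbT -(lerD2l ((\sum_(i < size s) p i) * (b - dotp l c))).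
  by rewrite key addr0 ler_pM2r.
move=> /psumr_eq0P gap0.
have Ki : (index K s' < size s')%N by rewrite index_mem.
have := gap0 (fun i _ => gap_ge0 i) (Ordinal Ki) isT.
rewrite /gap /= nth_index// => /eqP; rewrite mulf_eq0 gt_eqF//= subr_eq0.
by move=> /eqP.
Qed.

(** The first faces agree.  Using the comparison of weights in both
    directions, the two total weights are equal and each of the faces contains
    all nearest points of the other flag; by [face_determined] the faces contain
    each other.  Subtracting the total weight times the displacement from F to
    J then moves the base point to J, and induction applies. *)
Lemma face_path_inj (s s' : seq {set 'I_m}) F (p q : nat -> R) :
  F != finset.set0 -> path face_step F s -> path face_step F s' ->
  size s = size s' ->
  free [seq nearest K | K <- s] -> free [seq nearest K | K <- s'] ->
  (\dim (direction F) <= size s)%N ->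
  (forall i, 0 < p i) -> (forall i, 0 < q i) ->
  \sum_(i < size s) p i *: (nearest (nth finset.set0 s i) - nearest F) =
  \sum_(i < size s') q i *: (nearest (nth finset.set0 s' i) - nearest F) ->
  s = s'.
Proof.
elim: s s' F p q => [|J t IH] [|J' t'] F p q F0 //=.
move=> /andP[FJ Jt] /andP[FJ' Jt'] [szt] fr fr' dF p0 q0 e.
have /asboolP[fJ JF cJ] := FJ; have /asboolP[fJ' JF' cJ'] := FJ'.
have Fc : hull whole (nearest F) by apply: hull_whole (nearestP V F0).1.
have HJ := hull_head fJ Jt; have HJ' := hull_head fJ' Jt'.
have [_ [l [b sJ]]] := fJ; have [_ [l' [b' sJ']]] := fJ'.
have TJ K : K \in J :: t -> hull whole (nearest K) by move=> /HJ /hull_whole.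
have TJ' K : K \in J' :: t' -> hull whole (nearest K) by move=> /HJ' /hull_whole.
have [le1 eq1] := @weight_compare F J (J :: t) (J' :: t') p q l b sJ Fc cJ HJ TJ' q0 e.
have [le2 eq2] := @weight_compare F J' (J' :: t') (J :: t) q p l' b' sJ' Fc cJ' HJ' TJ p0 (esym e).
have dJ : (\dim (direction J) <= size t)%N.
  by rewrite -ltnS; apply: leq_trans dF; exact: face_step_dim.
have dJ' : (\dim (direction J') <= size t')%N.
  by rewrite -ltnS -szt; apply: leq_trans dF; exact: face_step_dim.
have JJ' : J = J'.
  apply/eqP; rewrite finset.eqEsubset; apply/andP; split; apply/fintype.subsetP => i iJ.
    have /(_ i iJ) := face_determined fr HJ dJ (eq2 le1).
    by have := sJ' i; case: ifP => // _ + lv; rewrite lv ltxx.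
  have /(_ i iJ) := face_determined fr' HJ' dJ' (eq1 le2).
  by have := sJ i; case: ifP => // _ + lv; rewrite lv ltxx.
subst J'; congr (_ :: _).
apply: (IH t' J (fun i => p i.+1) (fun i => q i.+1)) => //.
- by case: fJ.
- by move: fr; rewrite /= free_cons => /andP[].
- by move: fr'; rewrite /= free_cons => /andP[].
have rebase (r : nat -> R) (u : seq {set 'I_m}) :
    \sum_(i < size u) r i.+1 *: (nearest (nth finset.set0 u i) - nearest J) =
    \sum_(i < (size u).+1) r i *: (nearest (nth finset.set0 (J :: u) i) - nearest F) -
    (\sum_(i < (size u).+1) r i) *: (nearest J - nearest F).
  rewrite scaler_suml -sumrB big_ord_recl /= subrr add0r; apply: eq_bigr => i _.
  by rewrite -scalerBr opprB addrA subrK.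
rewrite !rebase; congr (_ - _ *: _); first exact: e.
by apply/eqP; rewrite eq_le le1 le2.
Qed.

End faces.

(** * Flags and their simplices *)

Section flags.
Context {R : realType} {m n : nat}.
Variable V : 'M[R]_(m, n).
Implicit Types (F J K : {set 'I_m}) (x y c u l : 'rV[R]_n).
Implicit Types (f g : n.-tuple {set 'I_m}).
Local Notation v i := (row i V).
Local Notation hull := (hull V).
Local Notation nearest := (nearest V).
Local Notation whole := (finset.setTfor 'I_m).
Local Notation direction := (direction V).
Local Notation is_face := (is_face V).
Local Notation face_step := (face_step V).

Hypothesis hull0 : hull whole 0.
Hypothesis far : forall J x, is_face J -> hull J x ->
  (n - \dim (direction J))%N%:R <= dotp x x.

(** A flag is a tuple of n vertex sets; its simplex is the image of
    [open_simplex] under this matrix. *)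
Definition flag_mx f : 'M[R]_n := \matrix_i nearest (tnth f i).

Lemma mul_flag_mx f x : x *m flag_mx f = \sum_i x 0 i *: nearest (tnth f i).
Proof. by rewrite mulmx_sum_row; apply: eq_bigr => i _; rewrite rowK. Qed.

Lemma nearest_whole : nearest whole = 0.
Proof.
have [_ /(_ 0 hull0)] := nearestP V (hull_nonempty hull0).
rewrite dotp0r => le0; apply/eqP; rewrite -dotp_eq0.
by rewrite eq_le le0 dotp_ge0.
Qed.

Lemma dim_direction_le J : (\dim (direction J) <= n)%N.
Proof. by apply: leq_trans (dimvS (subvf _)) _; rewrite dimvf dim_matrix mul1r. Qed.

Lemma flag_mx_free f : flag_mx f \in unitmx -> free [seq nearest K | K <- f].
Proof.
move=> uC; rewrite /free size_map size_tuple; apply/eqP.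
rewrite (_ : span _ = fullv) ?dimvf ?dim_matrix ?mul1r//.
apply/eqP; rewrite eqEsubv subvf; apply/subvP => x _.
rewrite -(mulmxKV uC x) mul_flag_mx; apply: memv_suml => i _; apply: memvZ.
by apply: memv_span; apply/mapP; exists (tnth f i); rewrite ?mem_tnth.
Qed.

Lemma flag_mx_inj f g x y :
  path face_step whole f -> path face_step whole g ->
  flag_mx f \in unitmx -> flag_mx g \in unitmx ->
  (forall i, 0 < x 0 i) -> (forall i, 0 < y 0 i) ->
  x *m flag_mx f = y *m flag_mx g -> f = g.
Proof.
move=> pf pg uf ug x0 y0 e; apply/val_inj => /=.
(* Any positive value beyond the last index serves to keep all weights
   positive. *)
pose ext (z : 'rV[R]_n) (i : nat) : R := if insub i is Some j then z 0 j else 1.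
have ext0 (z : 'rV[R]_n) : (forall i, 0 < z 0 i) -> forall i, 0 < ext z i.
  by move=> z0 i; rewrite /ext; case: insubP.
have extE z (h : n.-tuple {set 'I_m}) :
    \sum_(i < size h) ext z i *: (nearest (nth finset.set0 h i) - nearest whole) =
    z *m flag_mx h.
  rewrite mul_flag_mx size_tuple; apply: eq_bigr => i _.
  by rewrite nearest_whole subr0 /ext valK (tnth_nth finset.set0).
apply: (face_path_inj (hull_nonempty hull0) pf pg _ (flag_mx_free uf) (flag_mx_free ug)
  _ (ext0 x x0) (ext0 y y0)).
- by rewrite !size_tuple.
- by rewrite size_tuple dim_direction_le.
- by rewrite !extE.
Qed.

Lemma flag_codim f (i : 'I_n) : path face_step whole f ->
  (i < n - \dim (direction (tnth f i)))%N.
Proof.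
move=> pf; have := face_path_dim (hull_nonempty hull0) pf (i := i).
rewrite size_tuple => /(_ (ltn_ord i)); rewrite -tnth_nth => h.
by rewrite ltn_subRL; apply: leq_trans h (dim_direction_le _).
Qed.

Lemma flag_hull f (i k : 'I_n) : path face_step whole f -> (i <= k)%N ->
  hull (tnth f i) (nearest (tnth f k)).
Proof.
move=> pf ik; set a := tnth f i.
have : path face_step whole (take i f ++ drop i f) by rewrite cat_take_drop.
rewrite cat_path => /andP[_].
rewrite (drop_nth finset.set0) ?size_tuple// -tnth_nth -/a /= => /andP[/asboolP[fa _ _] pa].
apply: (hull_head fa pa).
have -> : a :: drop i.+1 f = drop i f.
  by rewrite [RHS](drop_nth finset.set0) ?size_tuple// -tnth_nth.
rewrite (tnth_nth finset.set0) -(subnKC ik) -nth_drop mem_nth//.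
by rewrite size_drop size_tuple ltn_sub2r// (leq_ltn_trans ik).
Qed.

(** The nearest point of the larger face F satisfies c.c <= c.x for all x in F,
    in particular for the nearest points of smaller faces. *)
Lemma flag_nearest_dotp f (i k : 'I_n) : path face_step whole f ->
  (minn i k).+1%:R <= dotp (nearest (tnth f i)) (nearest (tnth f k)).
Proof.
move=> pf; wlog ik : i k / (i <= k)%N.
  move=> h; have /orP[ik|ki] := leq_total i k; first exact: h.
  by rewrite minnC [leRHS]dotpC; exact: h.
rewrite (minn_idPl ik).
have fi : is_face (tnth f i) by apply: (face_path_faces pf (mem_tnth i f)).1.
have [ci cmin] := nearestP V fi.1.
apply: le_trans (cmin _ (flag_hull pf ik)); apply: le_trans (far fi ci).
by rewrite ler_nat; exact: flag_codim.
Qed.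

Lemma dotp_mul_mul p (A : 'M[R]_(p, n)) (x : 'rV[R]_p) :
  dotp (x *m A) (x *m A) =
  \sum_i \sum_k x 0 i * x 0 k * dotp (row i A) (row k A).
Proof.
rewrite !mulmx_sum_row dotp_suml; apply: eq_bigr => i _.
rewrite dotpZl dotp_sumr mulr_sumr; apply: eq_bigr => k _.
by rewrite dotpZr mulrA.
Qed.

(** For the cube the inequality of [flag_nearest_dotp] is an equality. *)
Lemma dotp_staircase (i k : 'I_n) :
  dotp (row i (@staircase R n)) (row k (@staircase R n)) = (minn i k).+1%:R.
Proof.
have ikn : (minn i k < n)%N by rewrite gtn_min ltn_ord.
rewrite /dotp (eq_bigr (fun j : 'I_n => (j < (minn i k).+1)%N%:R)); last first.
  by move=> j _; rewrite !mxE -natrM mulnb ltnS leq_min.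
by rewrite -natr_sum -big_mkcond (big_ord_narrow ikn) sum1_card card_ord.
Qed.

(** Compare the squared norms term by term in the Gram matrices. *)
Lemma flag_far f x : path face_step whole f -> (forall i, 0 < x 0 i) ->
  dotp (x *m @staircase R n) (x *m @staircase R n) <=
  dotp (x *m flag_mx f) (x *m flag_mx f).
Proof.
move=> pf x0; rewrite !dotp_mul_mul; apply: ler_sum => i _; apply: ler_sum => k _.
apply: ler_wpM2l; first by rewrite mulr_ge0// ltW.
rewrite dotp_staircase !rowK.
exact: flag_nearest_dotp.
Qed.

Lemma unit_row_neq0 (M : 'M[R]_n) i : M \in unitmx -> row i M != 0.
Proof.
move=> uM; apply/eqP => Mi; have := mulmxK uM (delta_mx 0 i : 'rV[R]_n).
rewrite -rowE Mi mul0mx => /(congr1 (fun x : 'rV[R]_n => x 0 i))/eqP.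
by rewrite !mxE !eqxx eq_sym oner_eq0.
Qed.

(** Dimensions drop along the faces of [face_path_cover], so there are at most n
    of them.  If there are fewer, or if some weight vanishes, then the matrix
    of the points used has a zero row. *)
Lemma flag_cover z : hull whole z ->
  (exists f x, [/\ path face_step whole f, flag_mx f \in unitmx,
                   open_simplex x & z = x *m flag_mx f]) \/
  exists f x, flag_mx f \notin unitmx /\ z = x *m flag_mx f.
Proof.
move=> Tz; have [s [a [ps a0 a1 zE]]] := face_path_cover (is_face_whole Tz) Tz.
have sn : (size s <= n)%N.
  case: (posnP (size s)) => [-> //|s0].
  have /(face_path_dim (hull_nonempty hull0) ps) : ((size s).-1 < size s)%N by rewrite prednK.
  move=> /leq_trans/(_ (dim_direction_le _)); apply: leq_trans.
  by rewrite -[X in (X <= _)%N](prednK s0) ltnS leq_addl.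
(* Faces of weight zero, and those beyond the end of s, become the empty set,
   whose nearest point is 0. *)
pose f := [tuple if 0 < a i.+1 then nth finset.set0 s i else finset.set0 | i < n].
pose x : 'rV[R]_n := \row_i a i.+1.
have zx : z = x *m flag_mx f.
  rewrite zE big_ord_recl /= nearest_whole scaler0 add0r mul_flag_mx.
  rewrite (big_ord_widen _ (fun i => a i.+1 *: nearest (nth finset.set0 s i)) sn).
  rewrite big_mkcond; apply: eq_bigr => i _; rewrite mxE tnth_mktuple.
  have [ai|] := ltP 0 (a i.+1); last first.
    by move=> ai; rewrite (@le_anti _ _ (a i.+1) 0) ?ai ?a0// !scale0r; case: ifP.
  by case: ltnP => // si; rewrite nth_default// nearest_set0 scaler0.
have [uf|nuf] := boolP (flag_mx f \in unitmx); last by right; exists f, x.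
left; exists f, x.
have fi (i : 'I_n) : 0 < a i.+1 /\ (i < size s)%N.
  have := unit_row_neq0 i uf; rewrite rowK tnth_mktuple.
  case: ltP => [ai|_]; last by rewrite nearest_set0 eqxx.
  by case: ltnP => // si; rewrite nth_default// nearest_set0 eqxx.
have sE : size s = n.
  apply/eqP; rewrite eqn_leq sn /=; case: (posnP n) => [-> //|n0].
  have np : (n.-1 < n)%N by rewrite prednK.
  by have [_] := fi (Ordinal np); rewrite /= prednK.
have fE : tval f = s.
  apply: (@eq_from_nth _ finset.set0) => [|i]; rewrite size_tuple ?sE// => ni.
  rewrite -[i]/(val (Ordinal ni)) -tnth_nth tnth_mktuple.
  by have [-> _] := fi (Ordinal ni).
split=> //; first by rewrite fE.
split=> [i|]; first by rewrite mxE; case: (fi i).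
under eq_bigr do rewrite mxE.
by rewrite -a1 sE big_ord_recl lerDr.
Qed.

(** Supplies the measurability of P.  A point x outside P is separated from P by
    the face in which the segment from 0 to x leaves P; the functional of that
    face is smaller at 0 than at the exit point, hence larger at x. *)
Lemma polytope_halfspaces (r2 : R) : 0 < r2 -> eball r2 `<=` hull whole ->
  exists h : {set 'I_m} -> 'rV[R]_n * R,
    hull whole = [set x | forall J, is_face J -> dotp (h J).1 x <= (h J).2].
Proof.
move=> r0 ball_hull.
have ex J : exists h : 'rV[R]_n * R, is_face J -> supports V h.1 h.2 J.
  have [fJ|nJ] := pselect (is_face J); last by exists (0, 0).
  by have [_ [l [b sJ]]] := fJ; exists (l, b).
have [h hP] := choice ex; exists h.
apply/seteqP; split => [x Tx J fJ|x hx]; first exact: supports_hull_le (hP J fJ) Tx.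
apply: contrapT => nTx.
have x0 : x != 0 by apply/eqP => x0; apply: nTx; rewrite x0.
have [t [l [b [t0 Ty tmax lT [ly lx]]]]] := hull_exit hull0 x0.
rewrite add0r in Ty ly.
(* With this e we have e <= 1 and e |x|^2 <= r2, so e x lies in the ball. *)
pose e := r2 / (r2 + dotp x x).
have d0 : 0 < r2 + dotp x x by rewrite ltr_pwDl// dotp_ge0.
have e0 : 0 < e by rewrite divr_gt0.
have t_gt0 : 0 < t.
  apply: lt_le_trans e0 (tmax _ _); rewrite add0r; apply: ball_hull.
  rewrite /eball /= dotpZl dotpZr.
  have ed : e * (r2 + dotp x x) = r2 by rewrite divfK// gt_eqF.
  have e1 : e <= 1 by rewrite ler_pdivrMr// mul1r lerDl dotp_ge0.
  have := dotp_ge0 x; nra.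
have t1 : t < 1.
  rewrite ltNge; apply/negP => t1; apply: nTx.
  have := @hull_convex _ _ _ V whole 0 (t *: x) t^-1 hull0 Ty.
  rewrite invr_ge0 t0 invf_le1// t1 => /(_ isT).
  by rewrite scaler0 add0r scalerA mulVf ?gt_eqF// scale1r.
set J := [set i in whole | dotp l (v i) == b]%SET.
have Jy : hull J (t *: x) by exact: hull_face.
have fJ : is_face J.
  by apply: is_face_sub (is_face_whole Ty) lT _; exact: hull_nonempty Jy.
have lJ : {in J, forall i, dotp l (v i) = b} by move=> i; rewrite inE => /andP[_ /eqP].
have J0 : ~ hull J 0.
  move=> /(hull_eq lJ); rewrite dotp0r => b0; move/eqP: ly.
  by rewrite dotpZr -b0 mulf_eq0 !gt_eqF.
have := supports_hull_lt (hP J fJ) hull0 J0; rewrite dotp0r => b0.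
have := hull_eq (fun i => @supports_eq _ _ _ V _ _ _ i (hP J fJ)) Jy.
rewrite dotpZr => ty; have := hx J fJ; rewrite -ty leNgt => /negP; apply.
by rewrite -ty pmulr_rgt0// in b0; rewrite gtr_pMl.
Qed.

Lemma hull_measurable (r2 : R) : 0 < r2 -> eball r2 `<=` hull whole ->
  row_measurable (hull whole).
Proof.
move=> r0 /(polytope_halfspaces r0)[h ->].
apply: (@row_measurable_bigcap R n _
  (fun J => [set x | is_face J -> dotp (h J).1 x <= (h J).2])) => J.
have [fJ|nJ] := pselect (is_face J); last first.
  rewrite (_ : mkset _ = setT); first exact: measurableT.
  by apply/seteqP; split => x //= _ /nJ.
rewrite (_ : mkset _ = [set x | dotp (h J).1 x <= (h J).2]); last first.
  by apply/seteqP; split => x /=; [exact|].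
apply: row_measurable_le; last exact: measurable_cst.
apply: measurable_sum => i; apply: measurable_funM; first exact: measurable_cst.
exact: measurable_row_of_tuple.
Qed.

Lemma flag_mx_hull f x : path face_step whole f -> open_simplex x ->
  hull whole (x *m flag_mx f).
Proof.
move=> pf [x0 x1]; set s := \sum_i _ in x1.
have s0 : 0 <= s by apply: sumr_ge0 => i _; exact: ltW.
have [s_eq0|s_neq0] := eqVneq s 0.
  rewrite (_ : x = 0) ?mul0mx//; apply/rowP => i; rewrite mxE.
  by have /psumr_eq0P := s_eq0; apply=> // j _; exact: ltW.
have Qy : hull whole (s^-1 *: x *m flag_mx f).
  apply: (@hull_sub_convex _ _ _ (flag_mx f) (finset.setTfor 'I_n)).
  - exact: hull_convex.
  - move=> i _; rewrite rowK; apply: hull_whole.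
    exact: face_path_nearest pf (mem_tnth i f).
  exists (s^-1 *: x) => //; split=> [i|i|]; last 2 first.
  - by rewrite inE.
  - by under eq_bigr do rewrite mxE; rewrite -mulr_sumr -/s mulVf.
  by rewrite mxE mulr_ge0 ?invr_ge0// ltW.
have := hull_convex hull0 Qy (t := s); rewrite s0 x1 => /(_ isT).
by rewrite scaler0 add0r -scalemxAl scalerA divff// scale1r.
Qed.

Lemma volume_hull_ge (r2 : R) : 0 < r2 -> eball r2 `<=` hull whole ->
  ((2 ^+ n)%:E <= volume (hull whole))%E.
Proof.
move=> r0 ball_hull.
pose K := {f : n.-tuple {set 'I_m} | path face_step whole f && (flag_mx f \in unitmx)}.
pose L := {f : n.-tuple {set 'I_m} | flag_mx f \notin unitmx}.
have KP (k : K) : path face_step whole (val k) /\ flag_mx (val k) \in unitmx.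
  by have /andP[] := valP k.
apply: (@volume_ge_of_chains R n _ r2 K L (fun k => flag_mx (val k))
  (fun g : L => flag_mx (val g))) => //.
- exact: hull_measurable ball_hull.
- by move=> k; case: (KP k).
- by move=> g; exact: valP g.
- by move=> k x Dx; have [pk _] := KP k; exact: flag_mx_hull.
- move=> k k' x y [x0 _] [y0 _] e; apply/val_inj; have [pk uk] := KP k.
  by have [pk' uk'] := KP k'; exact: flag_mx_inj e.
- by move=> k x [x0 _]; have [pk _] := KP k; exact: flag_far.
move=> z /ball_hull /flag_cover[[f [x [pf uf Dx zE]]]|[f [x [nuf zE]]]].
  have kf : path face_step whole f && (flag_mx f \in unitmx) by rewrite pf.
  by left; exists (Sub f kf), x; rewrite SubK.
by right; exists (Sub f nuf), x; rewrite SubK.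
Qed.

End flags.

(** * From the polytope to its faces *)

Section polytope.
Context {R : realType} {n : nat}.
Implicit Types (x y w : 'rV[R]_n).

Lemma convex_hullE (s : seq 'rV[R]_n) :
  convex_hull [set` s] =
  hull (\matrix_i tnth (in_tuple s) i) (finset.setTfor 'I_(size s)).
Proof.
set V := \matrix_i _; apply/seteqP; split.
  apply: smallest_sub => [|x /= xs].
    move=> x y t; rewrite !inE => hx hy.
    have t01 : 0 <= 1 - t%:num <= 1 by rewrite subr_ge0 le1 gerBl ge0.
    by have := hull_convex hx hy t01; rewrite opprB addrCA subrr addr0.
  have xs' : (index x s < size s)%N by rewrite index_mem.
  have -> : x = row (Ordinal xs') V by rewrite rowK (tnth_nth 0)/= nth_index.
  by apply: hull_vertex; rewrite inE.
apply: hull_sub_convex => [x y t Qx Qy /andP[t0 t1] Q QP|i _].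
  have s0 : 0 <= 1 - t by rewrite subr_ge0.
  have s1 : 1 - t <= 1 by rewrite gerBl.
  have := QP.1 x y (Itv01 s0 s1); rewrite !inE => /(_ (Qx Q QP) (Qy Q QP)).
  by congr Q; congr (_ + _ *: _); exact: subKr.
by rewrite rowK; apply: sub_gen_smallest; rewrite /= mem_tnth.
Qed.

Section face_spans.
Context {m : nat}.
Variable V : 'M[R]_(m, n).
Implicit Types (J : {set 'I_m}).
Local Notation whole := (finset.setTfor 'I_m).

(** An affine set containing the vertices is, seen from one of them, closed
    under scaling and addition, and so contains the direction space. *)
Lemma affine_span_hull J k : k \in J ->
  affine_span (hull V J) = [set row k V + w | w in [set` direction V J]].
Proof.
move=> kJ; apply/seteqP; split.
  apply: smallest_sub => [_ _ t [w /= wJ <-] [w' /= wJ' <-]|x Jx].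
    exists (t *: w + (1 - t) *: w').
      by rewrite /= memvD// memvZ.
    rewrite !scalerDr addrACA -scalerDl.
    by rewrite [t + _]addrC subrK scale1r.
  exists (x - row k V); last by rewrite addrC subrK.
  exact: hull_vertex_direction.
move=> _ [w /= wJ <-] A [affA sA].
pose Q u := A (row k V + u).
have Ak : Q 0 by rewrite /Q addr0; apply: sA; exact: hull_vertex.
have QZ a u : Q u -> Q (a *: u).
  move=> Qu; have := affA _ _ a Qu Ak; rewrite addr0 /Q; congr A.
  by apply/rowP => i; rewrite !mxE; ring.
have QD u u' : Q u -> Q u' -> Q (u + u').
  move=> Qu Qu'; have half : Q (2^-1 *: u + (1 - 2^-1) *: u').
    have := affA _ _ 2^-1 Qu Qu'; rewrite /Q; congr A.
    by apply/rowP => i; rewrite !mxE; ring.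
  have := QZ 2 _ half; congr Q.
  by apply/rowP => i; rewrite !mxE; field.
have Qv i : i \in J -> Q (row i V - row k V).
  by move=> iJ; rewrite /Q addrC subrK; apply: sA; exact: hull_vertex.
pose X := [seq row i V - row i' V | i <- enum J, i' <- enum J].
have := @coord_span _ _ _ (in_tuple X) w wJ => ->.
apply: (big_ind Q) => // j _; apply: (QZ).
have /allpairsP[[i i'] [/= + + ->]] : X`_j \in X by rewrite mem_nth.
rewrite !mem_enum => iJ iJ'; rewrite -(subrKA (row k V)); apply: QD; first exact: Qv.
by rewrite -opprB -scaleN1r; apply: QZ; exact: Qv.
Qed.

Lemma is_face_codim J : is_face V J ->
  face_codim (hull V whole) (hull V J) (n - \dim (direction V J)).
Proof.
move=> [J0 [l [b sJ]]]; have /set0Pn[k kJ] := J0; split.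
  split; first by exists (row k V); exact: hull_vertex.
  exists l, b; split=> [x Tx|]; first exact: supports_hull_le sJ Tx.
  apply/seteqP; split=> [x Jx|x [Tx /= lx]]; last exact: supports_hull sJ Tx lx.
  split; first exact: hull_whole Jx.
  by apply: hull_eq Jx => i; exact: supports_eq.
exists (\dim (direction V J)); last by rewrite subnKC// dim_direction_le.
by exists (row k V), (direction V J); split=> //; exact: affine_span_hull.
Qed.

Lemma edistance0_le (A : set 'rV[R]_n) x : A x -> edistance 0 A <= enorm x.
Proof.
move=> Ax; apply: ge_inf; last by exists x; rewrite ?subr0.
by exists 0 => _ [y _ <-]; exact: sqrtr_ge0.
Qed.

Lemma far_faces J x :
  (forall k F, face_codim (hull V whole) F k ->
     Num.sqrt (k%:R : R) <= edistance 0 (affine_span F)) ->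
  is_face V J -> hull V J x -> (n - \dim (direction V J))%N%:R <= dotp x x.
Proof.
move=> P_far fJ Jx; rewrite -(@ler_sqrt _ _ (dotp x x)) ?dotp_ge0//.
apply: le_trans (P_far _ _ (is_face_codim fJ)) _.
by apply: edistance0_le; exact: sub_gen_smallest.
Qed.

End face_spans.
End polytope.

Lemma interior_eball (R : realType) (n : nat) (P : set 'rV[R]_n) :
  interior P 0 -> exists2 r2 : R, 0 < r2 & eball r2 `<=` P.
Proof.
move=> /nbhs_ballP[e /= e0 eP]; exists ((e / 2) ^+ 2).
  by rewrite exprn_gt0// divr_gt0.
move=> x; rewrite /eball /= => xe; apply: eP.
split=> // i j; rewrite ord1 -ball_normE /ball_ /= mxE sub0r normrN.
have xj := le_trans (sqr_coord_le_dotp x j) xe.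
apply: (@le_lt_trans _ _ (e / 2)); last by rewrite gtr_pMr// invf_lt1// ltr1n.
rewrite -(@ler_pXn2r _ 2)// ?nnegrE//; first by rewrite real_normK ?num_real.
by rewrite divr_ge0// ltW.
Qed.

Theorem theorem1p1 (R : realType) (n : nat) (P : set 'rV[R]_n)
    (n_ge1 : (1 <= n)%N)
    (P_polytope : polytope P)
    (P_interior0 : interior P 0)
    (P_far : forall (k : nat) (F : set 'rV[R]_n), face_codim P F k ->
       Num.sqrt (k%:R : R) <= edistance 0 (affine_span F)) :
  (((2 : R) ^+ n)%:E <= volume P)%E.
Proof.
have [s PE] := P_polytope.
have [r2 r0 ballP] := interior_eball P_interior0.
rewrite PE convex_hullE in P_far ballP *.
have hull0 : hull (\matrix_i tnth (in_tuple s) i) (finset.setTfor 'I_(size s)) 0.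
  by apply: ballP; rewrite /eball /= dotp0l ltW.
apply: (volume_hull_ge hull0 _ r0 ballP).
by move=> J x; exact: far_faces.
Qed.
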